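(* Let $X$ be a full $d$-dimensional shift on a finite alphabet and $\Phi=(\Phi_{\Lambda})_{\Lambda\Subset \mathbb Z^d}$ be an interaction. If $\sum_{\Lambda\Subset \mathbb Z^d,\,\Lambda\ni 0}\|\Phi_\Lambda\|_\infty<\infty$ then $\Phi$ cannot have a freezing phase transition.
   Context: $X=\mathcal A^{\mathbb Z^d}$ with $\mathcal A$ finite and the shift action. A (shift-invariant) interaction $\Phi$ is a family of functions $\Phi_\Lambda:X\to\mathbb R$ indexed by finite subsets $\Lambda\Subset\mathbb Z^d$, each $\Phi_\Lambda$ depending only on $x|_\Lambda$. Its associated potential is $\phi=\sum_{\Lambda\Subset\mathbb Z^d,\,0\in\Lambda}\Phi_\Lambda/|\Lambda|$. $\Phi$ has a freezing phase transition if $\phi$ does, i.e. there is $\beta_c$ with $\mathrm{ES}(\beta\phi)=\mathrm{ES}(\beta'\phi)$ for all $\beta,\beta'>\beta_c$ while $\mathrm{ES}(\beta\phi)\ne\mathrm{ES}(\beta'\phi)$ for any $\beta<\beta_c<\beta'$, where $\mathrm{ES}(\beta\phi)$ is the set of shift-invariant probability measures $\mu$ maximizing $h(\mu)+\beta\int\phi\,d\mu$ ($h$ = measure-theoretic entropy). *)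

(* Defs.v *)
From HB Require Import structures.
From mathcomp Require Import all_boot all_order all_algebra finmap.
From mathcomp Require Import all_classical all_reals all_analysis.
Set Implicit Arguments. Unset Strict Implicit. Unset Printing Implicit Defensive.
Import Order.TTheory GRing.Theory Num.Theory.
Import numFieldNormedType.Exports.
Local Open Scope classical_set_scope.
Local Open Scope ring_scope.
Local Open Scope fset_scope.

Definition Zd (d : nat) : Type := 'rV[int]_d.

(* The alphabet A (a finite type), made pointed by a chosen letter a0
   (needed by MathComp-Analysis to build a measurable type). *)
Definition ptA (A : finType) (a0 : A) : Type := A.
HB.instance Definition _ (A : finType) (a0 : A) :=
  Choice.on (ptA a0).
HB.instance Definition _ (A : finType) (a0 : A) :=
  isPointed.Build (ptA a0) a0.

Definition cyl (d : nat) (A : Type) (L : {fset Zd d}) (w : Zd d -> A) :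
  set (Zd d -> A) := [set x | forall i, i \in L -> x i = w i].

Definition cylinders (d : nat) (A : Type) : set (set (Zd d -> A)) :=
  [set C | exists L w, C = @cyl d A L w].

(* The full shift X = A^(Z^d) with the sigma-algebra generated by cylinders
   (= the Borel sigma-algebra of the product topology). *)
Definition X (d : nat) (A : finType) (a0 : A) :=
  g_sigma_algebraType (@cylinders d (ptA a0)).

Definition shift (d : nat) (A : Type) (v : Zd d) (x : Zd d -> A) : Zd d -> A :=
  fun i => x (i + v)%R.

Definition shift_invariant (d : nat) (A : finType) (a0 : A) (R : realType)
  (mu : probability (X d a0) R) : Prop :=
  forall (v : Zd d) (B : set (X d a0)), measurable B ->
    mu ((@shift d A v) @^-1` B) = mu B.

Definition boxpt (d n : nat) (k : {ffun 'I_d -> 'I_(n.*2.+1)}) : Zd d :=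
  \row_(i < d) ((k i)%:Z - n%:Z)%R.

Definition boxcyl (d n : nat) (A : finType)
  (p : {ffun {ffun 'I_d -> 'I_(n.*2.+1)} -> A}) : set (Zd d -> A) :=
  [set x | forall k, x (boxpt k) = p k].

Definition Hbox (d : nat) (A : finType) (a0 : A) (R : realType)
  (mu : probability (X d a0) R) (n : nat) : R :=
  \sum_(p : {ffun {ffun 'I_d -> 'I_(n.*2.+1)} -> A})
     (let q := fine (mu (@boxcyl d n A p : set (X d a0))) in
      if q == 0 then 0 else - (q * ln q)).

(* Measure-theoretic (Kolmogorov-Sinai) entropy of a shift-invariant measure
   on the full shift, computed with the generating partition by the symbol at
   the origin: h(mu) = lim_n H_mu(box_n partition) / |box_n|. *)
Definition entropy (d : nat) (A : finType) (a0 : A) (R : realType)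
  (mu : probability (X d a0) R) : R :=
  limn (fun n => Hbox mu n / ((n.*2.+1) ^ d)%:R).

Definition supnorm (d : nat) (A : Type) (R : realType)
  (Phi : {fset Zd d} -> (Zd d -> A) -> R) (L : {fset Zd d}) : R :=
  sup (range (fun x => `|Phi L x|)).

Definition local_interaction (d : nat) (A : Type) (R : realType)
  (Phi : {fset Zd d} -> (Zd d -> A) -> R) : Prop :=
  forall L (x y : Zd d -> A), (forall i, i \in L -> x i = y i) ->
    Phi L x = Phi L y.

Definition shift_invariant_interaction (d : nat) (A : Type) (R : realType)
  (Phi : {fset Zd d} -> (Zd d -> A) -> R) : Prop :=
  forall (L : {fset Zd d}) (v : Zd d) (x : Zd d -> A),
    Phi [fset (i + v)%R | i in L] x = Phi L (shift v x).

Definition contains0 (d : nat) : set {fset Zd d} := [set L | (0 : Zd d) \in L].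

(* The potential phi = sum_{L containing 0} Phi_L / |L|, defined as an
   unconditional sum (positive part minus negative part). *)
Definition potential (d : nat) (A : Type) (R : realType)
  (Phi : {fset Zd d} -> (Zd d -> A) -> R) (x : Zd d -> A) : R :=
  fine (\esum_(L in @contains0 d) (Num.max (Phi L x / (#|` L|)%:R) 0)%:E)
  - fine (\esum_(L in @contains0 d) (Num.max (- (Phi L x / (#|` L|)%:R)) 0)%:E).

Definition free_energy (d : nat) (A : finType) (a0 : A) (R : realType)
  (phi : X d a0 -> R) (beta : R) (mu : probability (X d a0) R) : R :=
  entropy mu + beta * fine (\int[mu]_x (phi x)%:E).

Definition ES (d : nat) (A : finType) (a0 : A) (R : realType)
  (phi : X d a0 -> R) (beta : R) : set (probability (X d a0) R) :=
  [set mu | shift_invariant mu /\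
     forall nu : probability (X d a0) R, shift_invariant nu ->
       free_energy phi beta nu <= free_energy phi beta mu].

Definition freezing_phase_transition (d : nat) (A : finType) (a0 : A)
  (R : realType) (phi : X d a0 -> R) : Prop :=
  exists betac : R,
    (forall beta beta', betac < beta -> betac < beta' ->
       ES phi beta = ES phi beta') /\
    (forall beta beta', beta < betac -> betac < beta' ->
       ES phi beta <> ES phi beta').

(* Main.v *)
(** The pressure P(b) = max { h(mu) + b mu(phi) } is the limit of ln Z_n(b) / |B_n|,
and the maximum is attained. If a state mu maximizes for all b > bc, then P is
affine on (bc, +oo), and it suffices to compare this with the behaviour of Z_n.

Call the Hamiltonian trivial if any two configurations x, y differing at finitely
many sites have the same energy in the limit of large volumes. If it is not
trivial, fix such x, y with energy difference D > 0, and a box W so large that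
outside patterns change the difference by at most h, with h small against D.
Under the Gibbs measure at b, tile B_N by copies of W and turn pattern x
into y on each tile, independently with small probability e. If p and q are the
probabilities of x and y on a tile, then ln (p / q) >= - b (D + h), so a tile
contributes at least e p (- b (D + h)) - O(e^2 p) to the change of entropy, and
e p (D - h) to the change of energy. Testing the variational principle at b + 1
with the new measure, and at b - 1 with the Gibbs measure at b, shows that
ln Z_N(b - 1) + ln Z_N(b + 1) - 2 ln Z_N(b) >= c |B_N| with c > 0: P is not affine.

If the Hamiltonian is trivial, then the energy of a box is constant up to o(|B_n|),
so mu(phi) does not depend on the invariant measure mu and all ES(b phi) coincide. *)

Require Import Defs.
From HB Require Import structures.
From mathcomp Require Import all_boot all_order all_algebra finmap.
From mathcomp Require Import all_classical all_reals all_analysis measurable_realfun.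
From mathcomp Require Import lra zify.
Import Order.TTheory GRing.Theory Num.Theory.
Import numFieldNormedType.Exports.
Local Open Scope classical_set_scope.
Local Open Scope ring_scope.
Set Implicit Arguments. Unset Strict Implicit. Unset Printing Implicit Defensive.

(** * Shannon entropy of finite distributions *)

(** The contradiction is reached in finite volume, with free boundary conditions: no infinite-volume
    Gibbs measure or DLR equation occurs, and an equilibrium state enters only through the
    asymptotics of [ln (Z n b)]. The gain must be proportional to [#|box N|], so every tile has to
    show the first pattern with probability at least some [pmin] that does not depend on [N]. This
    is what summability of the norms, without division by cardinality, provides: changing finitely
    many sites costs a bounded energy whatever the surroundings, and distant sets have a uniformly
    small influence. Per tile, the gain at [b + 1] is to first order [e p ((b + 1)(D - h) - b (D +
    h)) = e p (D - (2b + 1) h)], which explains the constant [(2 * b + 1) * h]. Limits of measures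
    are needed for the maximisers and for the pressure. They are taken among positive normalised
    functionals on cylinder functions, which include Gibbs laws on boxes, their averages over
    translates and ultralimits of these; countable additivity is restored only afterwards, by
    Kolmogorov extension. *)

Section FiniteEntropy.
Variable R : realType.
Implicit Types a b p q e : R.

Definition eta a : R := if a == 0 then 0 else - (a * ln a).

Lemma eta0 : eta 0 = 0. Proof. by rewrite /eta eqxx. Qed.

Lemma etaE a : eta a = - (a * ln a).
Proof. by rewrite /eta; case: eqP => // ->; rewrite mul0r oppr0. Qed.

Lemma ln_le_sub1 a : 0 < a -> ln a <= a - 1.
Proof.
move=> a0; have := @le_ln1Dx R (a - 1).
by rewrite (_ : 1 + (a - 1) = a); [apply; lra | lra].
Qed.

(* By concavity [eta] lies below its tangent at [b]; every entropy inequality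
   below is an instance of this bound, which also covers [a = 0]. *)
Lemma eta_le_tangent a b : 0 <= a -> 0 < b -> eta a <= b - a - a * ln b.
Proof.
move=> a0 b0; rewrite etaE; have [->|an0] := eqVneq a 0; first by lra.
have {}a0 : 0 < a by rewrite lt_neqAle eq_sym an0.
have : ln (b / a) <= b / a - 1 by apply: ln_le_sub1; rewrite divr_gt0.
rewrite ln_div // => h.
have : a * (ln b - ln a) <= a * (b / a - 1) by rewrite ler_pM2l.
have -> : a * (b / a - 1) = b - a by rewrite mulrBr mulr1 mulrCA divff // mulr1.
lra.
Qed.

Lemma eta_ge0 a : 0 <= a -> a <= 1 -> 0 <= eta a.
Proof. by move=> a0 a1; rewrite etaE -mulrN mulr_ge0 // oppr_ge0 ln_le0. Qed.

(** Gibbs variational inequality: take the tangent of [eta] at the Gibbs weight [expR (E s) / Z].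
    Both families have mass 1, so the linear terms cancel and [ln Z] remains. *)
Lemma gibbs_le (S : finType) (P E : S -> R) :
  (forall s, 0 <= P s) -> \sum_s P s = 1 ->
  \sum_s eta (P s) + \sum_s P s * E s <= ln (\sum_s expR (E s)).
Proof.
move=> P0 P1; set Z := \sum_s expR _.
have [s0 _|S0] := pickP (@predT S); last first.
  move: P1; rewrite big_pred0; last by move=> s; have := S0 s.
  by move/eqP; rewrite eq_sym oner_eq0.
have Z0 : 0 < Z.
  rewrite /Z (bigD1 s0) //=; apply: ltr_wpDr; last exact: expR_gt0.
  by apply: sumr_ge0 => s _; exact: expR_ge0.
have -> : ln Z = \sum_s (expR (E s) / Z - P s - P s * (E s - ln Z) + P s * E s).
  under eq_bigr do rewrite mulrBr.
  rewrite !big_split /= !sumrN big_split /= sumrN -!mulr_suml P1 divff ?gt_eqF //.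
  lra.
rewrite -big_split /=; apply: ler_sum => s _; rewrite lerD2r.
have := @eta_le_tangent (P s) (expR (E s) / Z) (P0 s).
by rewrite divr_gt0 ?expR_gt0 // ln_div ?posrE ?expR_gt0 // expRK; apply.
Qed.

Lemma sum_eta_le_ln_card (S : finType) (P : S -> R) :
  (forall s, 0 <= P s) -> \sum_s P s = 1 ->
  \sum_s eta (P s) <= ln (#|S|%:R).
Proof.
move=> P0 P1; have := @gibbs_le _ _ (fun=> 0) P0 P1.
rewrite [X in _ + X]big1 ?addr0 => [|s _]; last by rewrite mulr0.
by under [X in ln X]eq_bigr do rewrite expR0; rewrite sumr_const.
Qed.

Lemma eta_sum_le (I : Type) (r : seq I) (w : I -> R) :
  (forall i, 0 <= w i) -> eta (\sum_(i <- r) w i) <= \sum_(i <- r) eta (w i).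
Proof.
move=> w0; elim: r => [|i r IH]; first by rewrite !big_nil eta0.
rewrite !big_cons; apply: (le_trans _ (lerD (lexx _) IH)).
set s := \sum_(_ <- _) _; have s0 : 0 <= s by apply: sumr_ge0.
have [->|wn0] := eqVneq (w i) 0; first by rewrite !add0r eta0 add0r.
have [->|sn0] := eqVneq s 0; first by rewrite !addr0 eta0 addr0.
have wi : 0 < w i by rewrite lt_neqAle eq_sym wn0 w0.
have sp : 0 < s by rewrite lt_neqAle eq_sym sn0.
have h1 : ln (w i) <= ln (w i + s) by rewrite ler_ln ?posrE ?lerDl // addr_gt0.
have h2 : ln s <= ln (w i + s) by rewrite ler_ln ?posrE ?lerDr // addr_gt0.
have h3 : w i * ln (w i) <= w i * ln (w i + s) by rewrite ler_pM2l.
have h4 : s * ln s <= s * ln (w i + s) by rewrite ler_pM2l.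
rewrite !etaE; lra.
Qed.

(** Jensen with the tangent at the mean [y]; a mean equal to 0 is treated apart, since the tangent
    needs a positive base point. *)
Lemma eta_concave (I : finType) (c x : I -> R) :
  (forall i, 0 <= c i) -> \sum_i c i = 1 -> (forall i, 0 <= x i) ->
  \sum_i c i * eta (x i) <= eta (\sum_i c i * x i).
Proof.
move=> c0 c1 x0; set y := \sum_i _ * x i.
have y0 : 0 <= y by apply: sumr_ge0 => i _; rewrite mulr_ge0.
have [y0'|yn0] := eqVneq y 0.
  rewrite y0' eta0 big1 // => i _.
  have /eqP := y0'; rewrite psumr_eq0 => [/allP /(_ i)|j _]; last exact: mulr_ge0.
  rewrite mem_index_enum => /(_ isT) /=; rewrite mulf_eq0 => /orP[] /eqP ->.
    by rewrite mul0r.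
  by rewrite eta0 mulr0.
have yp : 0 < y by rewrite lt_neqAle eq_sym yn0.
apply: (@le_trans _ _ (\sum_i (c i * y - c i * x i - c i * x i * ln y))).
  apply: ler_sum => i _; rewrite -[X in _ <= _ - X]mulrA -!mulrBr.
  by rewrite ler_wpM2l // eta_le_tangent.
by rewrite !big_split /= !sumrN -!mulr_suml c1 -/y etaE; lra.
Qed.

(** Strong subadditivity of Shannon entropy, without normalisation. The tangent is taken at
    [x s u * y t u / z u], the law that makes [s] and [t] independent given [u]: it has the same
    mass as [w], and its logarithm splits into marginals. *)
Lemma eta_submodular (S T U : finType) (w : S -> T -> U -> R) :
  (forall s t u, 0 <= w s t u) ->
  \sum_s \sum_t \sum_u eta (w s t u)
    + \sum_u eta (\sum_s \sum_t w s t u)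
  <= \sum_s \sum_u eta (\sum_t w s t u) + \sum_t \sum_u eta (\sum_s w s t u).
Proof.
move=> w0.
pose x s u := \sum_t w s t u; pose y t u := \sum_s w s t u.
pose z u := \sum_s \sum_t w s t u.
have x0 s u : 0 <= x s u by apply: sumr_ge0.
have y0 t u : 0 <= y t u by apply: sumr_ge0.
have z0 u : 0 <= z u by apply: sumr_ge0 => s _; apply: sumr_ge0.
have zx u : \sum_s x s u = z u by [].
have zy u : \sum_t y t u = z u by rewrite /z exchange_big.
have lewx s t u : w s t u <= x s u.
  by rewrite /x (bigD1 t) //= lerDl sumr_ge0.
have lewy s t u : w s t u <= y t u.
  by rewrite /y (bigD1 s) //= lerDl sumr_ge0.
have lexz s u : x s u <= z u by rewrite -zx (bigD1 s) //= lerDl sumr_ge0.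
have key s t u : eta (w s t u) <= x s u * y t u / z u - w s t u
   - w s t u * ln (x s u) - w s t u * ln (y t u) + w s t u * ln (z u).
  have [->|wn0] := eqVneq (w s t u) 0.
    rewrite eta0 !mul0r !subr0 addr0; apply: divr_ge0 => //; exact: mulr_ge0.
  have wp : 0 < w s t u by rewrite lt_neqAle eq_sym wn0 w0.
  have xp := lt_le_trans wp (lewx s t u); have yp := lt_le_trans wp (lewy s t u).
  have zp := lt_le_trans xp (lexz s u).
  have := @eta_le_tangent (w s t u) (x s u * y t u / z u) (w0 _ _ _).
  rewrite divr_gt0 ?mulr_gt0 // => /(_ isT).
  by rewrite ln_div ?lnM ?posrE ?mulr_gt0 //; lra.
have E1 : \sum_s \sum_u eta (x s u) =
    \sum_s \sum_t \sum_u - (w s t u * ln (x s u)).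
  apply: eq_bigr => s _; rewrite exchange_big; apply: eq_bigr => u _ /=.
  by rewrite sumrN -mulr_suml etaE.
have E2 : \sum_t \sum_u eta (y t u) =
    \sum_s \sum_t \sum_u - (w s t u * ln (y t u)).
  rewrite [RHS]exchange_big; apply: eq_bigr => t _ /=.
  rewrite exchange_big; apply: eq_bigr => u _ /=.
  by rewrite sumrN -mulr_suml etaE.
have E3 : \sum_u eta (z u) = \sum_s \sum_t \sum_u - (w s t u * ln (z u)).
  rewrite -[RHS](eq_bigr _ (fun s _ => exchange_big _ _ _ _ _ _)) /=.
  rewrite exchange_big; apply: eq_bigr => u _ /=.
  rewrite etaE /z mulr_suml -sumrN; apply: eq_bigr => s _.
  by rewrite mulr_suml -sumrN.
have le0 : \sum_s \sum_t \sum_u (x s u * y t u / z u - w s t u) <= 0.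
  rewrite -(eq_bigr _ (fun s _ => exchange_big _ _ _ _ _ _)) /=.
  rewrite exchange_big; apply: sumr_le0 => u _ /=.
  under eq_bigr do rewrite sumrB -mulr_suml -mulr_sumr zy.
  rewrite sumrB -!mulr_suml zx -/(z u).
  have [->|zn0] := eqVneq (z u) 0; first by rewrite !mul0r subrr.
  by rewrite mulfK // subrr.
have sum3D F G : \sum_s \sum_t \sum_u (F s t u + G s t u : R) =
    \sum_s \sum_t \sum_u F s t u + \sum_s \sum_t \sum_u G s t u.
  rewrite -big_split /=; apply: eq_bigr => s _; rewrite -big_split /=.
  by apply: eq_bigr => t _; rewrite -big_split.
have : \sum_s \sum_t \sum_u eta (w s t u) + \sum_u eta (z u)
    <= \sum_s \sum_t \sum_u (x s u * y t u / z u - w s t u)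
       + (\sum_s \sum_u eta (x s u) + \sum_t \sum_u eta (y t u)).
  rewrite E1 E2 E3 -!sum3D; apply: ler_sum => s _; apply: ler_sum => t _.
  by apply: ler_sum => u _; have := key s t u; lra.
move: le0; rewrite /x /y /z; lra.
Qed.
End FiniteEntropy.

(** * Strict convexity of a finite log-partition function *)

Section Swap.
Variables (R : realType) (O : finType).
Implicit Types (P : O -> R) (s : O -> O) (U : pred O) (e : R).

(* The law of a [P]-distributed point after each [x] in [U] has been moved to
   [s x] with probability [e]. *)
Definition pushswap s U e P (x : O) : R :=
  if U x then (1 - e) * P x else if U (s x) then P x + e * P (s x) else P x.

Lemma pushswap_sum s U e P (f : O -> R) :
  involutive s -> (forall x, U x -> ~~ U (s x)) ->
  \sum_x pushswap s U e P x * f x =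
  \sum_x P x * f x + e * \sum_(x | U x) P x * (f (s x) - f x).
Proof.
move=> sK sU.
have -> : \sum_(x | U x) P x * (f (s x) - f x) =
    \sum_(x | U (s x)) P (s x) * f x - \sum_(x | U x) P x * f x.
  under eq_bigr do rewrite mulrBr; rewrite sumrB; congr (_ - _).
  by rewrite [RHS](reindex_inj (inv_inj sK)); apply: eq_big => x; rewrite /= sK.
rewrite mulrBr !mulr_sumr (big_mkcond (fun x => U (s x))) (big_mkcond U) /=.
rewrite -sumrB -big_split /=; apply: eq_bigr => x _; rewrite /pushswap.
have [Ux|nUx] := boolP (U x); first by rewrite (negPf (sU _ Ux)); lra.
by case: ifP => _; lra.
Qed.

Lemma pushswap_gt0 s U e P : 0 < e < 1 -> (forall x, 0 < P x) ->
  forall x, 0 < pushswap s U e P x.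
Proof.
move=> /andP[e0 e1] P0 x; rewrite /pushswap; case: ifP => _.
  by rewrite mulr_gt0 // subr_gt0.
by case: ifP => // _; rewrite addr_gt0 // mulr_gt0.
Qed.

(* The right-hand side is convex and homogeneous in [(a, b)], hence lies above
   its tangent at [(p, q)]. The tangent is linear, so that summing over all
   pairs [(x, s x)] only involves the total masses [p] and [q]. *)
Lemma eta_swap_ge e (a b p q : R) : 0 < e < 1 -> 0 < a -> 0 < b -> 0 < p -> 0 < q ->
  a * (- ((1 - e) * ln (1 - e)) + e * (ln p - ln (q + e * p)))
   + b * (ln q - ln (q + e * p)) <=
  eta ((1 - e) * a) - eta a + (eta (b + e * a) - eta b).
Proof.
move=> /andP[e0 e1] a0 b0 p0 q0; set r := q + e * p.
have r0 : 0 < r by rewrite addr_gt0 // mulr_gt0.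
have e1' : 0 < 1 - e by rewrite subr_gt0.
have ea : 0 < e * a by rewrite mulr_gt0.
have ep : 0 < e * p by rewrite mulr_gt0.
have c0 : 0 < b + e * a by rewrite addr_gt0.
set c := b + e * a in c0 *.
(* The base points split [c] in the proportion [q : e * p] of the total masses and add up to [c], so
   the linear terms of the two tangents cancel. *)
have h1 := @eta_le_tangent R b (c * q / r) (ltW b0).
have h2 := @eta_le_tangent R (e * a) (c * (e * p) / r) (ltW ea).
rewrite divr_gt0 ?mulr_gt0 // in h1; move: (h1 isT) => {}h1.
rewrite divr_gt0 ?mulr_gt0 // in h2; move: (h2 isT) => {}h2.
move: h1 h2; rewrite !ln_div ?posrE ?mulr_gt0 // !lnM ?posrE ?mulr_gt0 //.
have : c * q / r + c * (e * p) / r = c by rewrite -mulrDl -mulrDr mulfK // gt_eqF.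
rewrite !etaE !lnM ?posrE //.
by move: (ln a) (ln b) (ln c) (ln e) (ln p) (ln q) (ln r) (ln (1 - e)) (c * q / r)
  (c * (e * p) / r) => la lb lc le lp lq lr l1 x y; rewrite /c; nra.
Qed.

(** Summing [eta_swap_ge] leaves only [p] and [q]. The bound [ln (1 - e) <= - e] yields
    [e (1 - e) p] on the thinned points, which pays, up to [e^2 p], for the [e p] lost on their
    targets; replacing [ln (q + e p)] by [ln q] costs at most [e^2 p^2 / q]. *)
Lemma pushswap_entropy s U e P p q :
  involutive s -> (forall x, U x -> ~~ U (s x)) -> 0 < e < 1 ->
  (forall x, 0 < P x) ->
  p = \sum_(x | U x) P x -> q = \sum_(x | U x) P (s x) ->
  \sum_x eta (P x) + (e * p * (ln p - ln q) - e ^+ 2 * (p ^+ 2 / q + p))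
  <= \sum_x eta (pushswap s U e P x).
Proof.
move=> sK sU e01 P0 pE qE; have /andP[e0 e1] := e01.
have -> : \sum_x eta (pushswap s U e P x) = \sum_x eta (P x) +
   \sum_(x | U x) (eta ((1 - e) * P x) - eta (P x) +
     (eta (P (s x) + e * P x) - eta (P (s x)))).
  rewrite big_split /=.
  have -> : \sum_(x | U x) (eta (P (s x) + e * P x) - eta (P (s x))) =
      \sum_(x | U (s x)) (eta (P x + e * P (s x)) - eta (P x)).
    rewrite (reindex_inj (inv_inj sK)) /=.
    by apply: eq_bigr => x _; rewrite sK.
  rewrite (big_mkcond U) (big_mkcond (fun x => U (s x))) /= -!big_split /=.
  apply: eq_bigr => x _; rewrite /pushswap.
  have [Ux|nUx] := boolP (U x); first by rewrite (negPf (sU _ Ux)); lra.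
  by case: ifP => _; lra.
rewrite lerD2l.
have [U0|Un0] := eqVneq p 0.
  have q0 : q = 0.
    rewrite qE big1 // => x Ux; rewrite pE in U0.
    have Px := psumr_eq0P (fun i _ => ltW (P0 i)) U0 Ux.
    by have := P0 x; rewrite Px ltxx.
  rewrite big1 ?U0 ?q0; first by rewrite expr0n /=; lra.
  move=> x Ux; rewrite pE in U0.
  have Px := psumr_eq0P (fun i _ => ltW (P0 i)) U0 Ux.
  by have := P0 x; rewrite Px ltxx.
have p0 : 0 < p.
  by rewrite lt_neqAle eq_sym Un0 /= pE sumr_ge0 // => x _; exact: ltW.
have q0 : 0 < q.
  have [x Ux|U0] := pickP U.
    rewrite qE (bigD1 x) //=; apply: ltr_wpDr => //.
    by apply: sumr_ge0 => y _; exact: ltW.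
  by move: p0; rewrite pE big_pred0 // ltxx.
apply: le_trans; last first.
  apply: ler_sum => x Ux; exact: (eta_swap_ge e01 (P0 x) (P0 (s x)) p0 q0).
rewrite big_split /= -!mulr_suml -pE -qE.
have h1 : ln (1 - e) <= - e.
  by have := @ln_le_sub1 R (1 - e); rewrite subr_gt0 => /(_ e1); lra.
have h2 : ln (q + e * p) - ln q <= e * p / q.
  have -> : ln (q + e * p) - ln q = ln ((q + e * p) / q).
    by rewrite ln_div // posrE addr_gt0 // mulr_gt0.
  apply: le_trans (@ln_le_sub1 R _ _) _; first by rewrite divr_gt0 // addr_gt0 // mulr_gt0.
  by rewrite mulrDl divff ?gt_eqF //; lra.
have h3 : q * (ln (q + e * p) - ln q) <= e * p.
  have : q * (ln (q + e * p) - ln q) <= q * (e * p / q) by rewrite ler_pM2l.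
  by rewrite [X in _ <= X]mulrC divfK // gt_eqF.
have h4 : e * p * (ln (q + e * p) - ln q) <= e ^+ 2 * (p ^+ 2 / q).
  have : e * p * (ln (q + e * p) - ln q) <= e * p * (e * p / q).
    by rewrite ler_pM2l // mulr_gt0.
  by rewrite (_ : e * p * (e * p / q) = e ^+ 2 * (p ^+ 2 / q)) //; lra.
have h5 : p * ((1 - e) * e) <= p * - ((1 - e) * ln (1 - e)).
  by rewrite ler_pM2l // -mulrN ler_pM2l ?subr_gt0 //; lra.
lra.
Qed.

End Swap.

Section StrictConvexity.
Variables (R : realType) (O : finType) (E : O -> R).

Definition Zpart (b : R) : R := \sum_x expR (b * E x).
Definition gibbs (b : R) (x : O) : R := expR (b * E x) / Zpart b.

Variable x0 : O.

Lemma Zpart_gt0 b : 0 < Zpart b.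
Proof.
rewrite /Zpart (bigD1 x0) //=; apply: ltr_wpDr; last exact: expR_gt0.
by apply: sumr_ge0 => s _; exact: expR_ge0.
Qed.

Lemma gibbs_gt0 b x : 0 < gibbs b x.
Proof. by rewrite divr_gt0 ?expR_gt0 ?Zpart_gt0. Qed.

Lemma gibbs_sum b : \sum_x gibbs b x = 1.
Proof. by rewrite -mulr_suml divff // gt_eqF // Zpart_gt0. Qed.

Lemma gibbs_entropy b :
  \sum_x eta (gibbs b x) + b * \sum_x gibbs b x * E x = ln (Zpart b).
Proof.
rewrite mulr_sumr -big_split /= -[RHS]mul1r -[in RHS](gibbs_sum b) mulr_suml.
apply: eq_bigr => x _; rewrite etaE {2}/gibbs ln_div ?posrE ?expR_gt0 ?Zpart_gt0 //.
by rewrite expRK; lra.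
Qed.

(** [s j] exchanges two patterns at the site [j]; [U j] holds where the first one is shown, hence
    [U j (s j x)] where the second one is. By [UU] and [UW] a move at [j] neither creates nor
    destroys a pattern at another site. *)
Variables (J : eqType) (r : seq J) (s : J -> O -> O) (U : J -> pred O).
Hypotheses (runiq : uniq r) (sK : forall j, j \in r -> involutive (s j))
  (sU : forall j, j \in r -> forall x, U j x -> ~~ U j (s j x))
  (UU : forall j l x, j \in r -> l \in r -> j != l -> U l (s j x) = U l x)
  (UW : forall j l x, j \in r -> l \in r -> j != l -> U l (s l (s j x)) = U l (s l x)).
Variables (b2 b3 D h e : R).
Hypotheses (e01 : 0 < e < 1) (b20 : 0 < b2) (b23 : b2 <= b3) (hD : 0 <= D - h)
  (dE : forall j x, j \in r -> U j x -> D - h <= E (s j x) - E x <= D + h).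

Let p (P : O -> R) j := \sum_(x | U j x) P x.
Let q (P : O -> R) j := \sum_(x | U j x) P (s j x).

(* The moves are applied one after the other. A move at [j] does not change the
   masses [p] and [q] at the other sites, so their ratio, which governs the first
   order of the entropy change, stays the one of the Gibbs measure. *)
Lemma ln_Zpart_perturb :
  ln (Zpart b2) + (b3 - b2) * (\sum_x gibbs b2 x * E x)
   + e * (b3 * (D - h) - b2 * (D + h) - 2 * e) * \sum_(j <- r) p (gibbs b2) j
  <= ln (Zpart b3).
Proof.
have /andP[e0 e1] := e01.
set g := gibbs b2; set k := _ - 2 * e.
(* One move raises the energy term by at least [b3 e p (D - h)]. The Gibbs weights give
   [1 <= q / p <= expR (b2 (D + h))]: the upper bound controls the first-order entropy loss, the
   lower one reduces the error to [2 e^2 p]. *)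
have step (j : J) P : j \in r -> (forall x, 0 < P x) -> p P j = p g j -> q P j = q g j ->
   \sum_x eta (P x) + b3 * (\sum_x P x * E x) + e * k * p g j <=
   \sum_x eta (pushswap (s j) (U j) e P x)
    + b3 * (\sum_x pushswap (s j) (U j) e P x * E x).
  move=> jr P0 pE qE.
  have := @pushswap_entropy R O _ _ e P _ _ (sK jr) (sU jr) e01 P0
    (esym pE) (esym qE); move=> H.
  rewrite (pushswap_sum e P E (sK jr) (sU jr)).
  have pg0 : 0 <= p g j by apply: sumr_ge0 => x _; exact/ltW/gibbs_gt0.
  have HE : p g j * (D - h) <= \sum_(x | U j x) P x * (E (s j x) - E x).
    rewrite -pE /p mulr_suml; apply: ler_sum => x Ux.
    by rewrite ler_pM2l //; have /andP[] := dE jr Ux.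
  have gs x : g (s j x) = g x * expR (b2 * (E (s j x) - E x)).
    rewrite /g /gibbs mulrAC -expRD; congr (expR _ / _); lra.
  have pq : p g j <= q g j.
    apply: ler_sum => x Ux; rewrite gs ler_peMr ?(ltW (gibbs_gt0 _ _)) //.
    rewrite -expR0 ler_expR mulr_ge0 ?(ltW b20) //.
    by have /andP[h1 _] := dE jr Ux; apply: le_trans h1.
  have qp : q g j <= p g j * expR (b2 * (D + h)).
    rewrite /p mulr_suml; apply: ler_sum => x Ux; rewrite gs ler_pM2l ?gibbs_gt0 //.
    by rewrite ler_expR ler_pM2l //; have /andP[] := dE jr Ux.
  have [pz|pn0] := eqVneq (p g j) 0.
    move: H HE; rewrite pz !mulr0 !mul0r expr0n /= mul0r !addr0 mulr0 subr0 addr0.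
    move=> H; rewrite mulrDr => HE.
    have : 0 <= b3 * (e * \sum_(x | U j x) P x * (E (s j x) - E x)).
      by rewrite !mulr_ge0 ?(ltW e0) // (le_trans (ltW b20)).
    lra.
  have pp : 0 < p g j by rewrite lt_neqAle eq_sym pn0.
  have qq := lt_le_trans pp pq.
  have l1 : - (b2 * (D + h)) <= ln (p g j) - ln (q g j).
    rewrite -ler_ln ?posrE ?mulr_gt0 ?expR_gt0 // lnM ?posrE ?expR_gt0 // expRK in qp.
    lra.
  have l2 : p g j ^+ 2 / q g j <= p g j by rewrite ler_pdivrMr // expr2 ler_pM2l.
  have l3 : e * p g j * - (b2 * (D + h)) <= e * p g j * (ln (p g j) - ln (q g j)).
    by rewrite ler_pM2l // mulr_gt0.
  have l4 : e ^+ 2 * (p g j ^+ 2 / q g j + p g j) <= e ^+ 2 * (2 * p g j).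
    by rewrite ler_pM2l ?exprn_gt0 //; lra.
  have l5 : b3 * (e * (p g j * (D - h))) <=
      b3 * (e * \sum_(x | U j x) P x * (E (s j x) - E x)).
    by rewrite ler_pM2l ?(lt_le_trans b20) // ler_pM2l.
  rewrite /k; lra.
have iter (t : seq J) : uniq t -> {subset t <= r} -> exists P : O -> R,
   [/\ forall x, 0 < P x, \sum_x P x = 1,
     forall l, l \in r -> l \notin t -> p P l = p g l /\ q P l = q g l &
     \sum_x eta (g x) + b3 * (\sum_x g x * E x) + e * k * \sum_(j <- t) p g j
     <= \sum_x eta (P x) + b3 * (\sum_x P x * E x)].
  elim: t => [|j t IH] /=.
    move=> _ _; exists g; split => //; [exact: gibbs_gt0|exact: gibbs_sum|].
    by rewrite big_nil mulr0 addr0.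
  move=> /andP[jt ut] tr; have jr : j \in r by apply: tr; rewrite mem_head.
  have [|P [P0 P1 PI PE]] := IH ut.
    by move=> l lt; apply: tr; rewrite inE lt orbT.
  have [pj qj] := PI j jr jt.
  exists (pushswap (s j) (U j) e P); split.
  - exact: pushswap_gt0.
  - have := pushswap_sum e P (fun=> 1) (sK jr) (sU jr).
    rewrite (eq_bigr _ (fun _ _ => mulr1 _)) (eq_bigr _ (fun _ _ => mulr1 _)) => ->.
    by rewrite P1 big1 ?mulr0 ?addr0 // => x _; rewrite subrr mulr0.
  - move=> l lr; rewrite inE negb_or => /andP[lj lt].
    have [<- <-] := PI l lr lt; have jl : j != l by rewrite eq_sym.
    have pushI (V : pred O) Q : (forall x, V (s j x) = V x) ->
       \sum_(x | V x) pushswap (s j) (U j) e Q x = \sum_(x | V x) Q x.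
      move=> VI; rewrite !(big_mkcond V) /=.
      have := pushswap_sum e Q (fun x => (V x)%:R) (sK jr) (sU jr).
      rewrite [X in _ + e * X]big1 => [|x _]; last by rewrite VI subrr mulr0.
      rewrite mulr0 addr0 => HH; apply: etrans (etrans HH _);
        by apply: eq_bigr => x _; case: (V x); rewrite ?mulr1 ?mulr0.
    split; first by apply: pushI => x; rewrite UU.
    have qE Q : q Q l = \sum_(x | U l (s l x)) Q x.
      rewrite /q [LHS](reindex_inj (inv_inj (sK lr))) /=.
      by apply: eq_bigr => x _; rewrite (sK lr).
    by rewrite !qE; apply: pushI => x; rewrite UW.
  - have := step j P jr P0 pj qj; rewrite big_cons; lra.
have [P [P0 P1 _ PE]] := iter r runiq (fun _ => id).
(* The final law is a trial state at [b3]. The Gibbs identity at [b2] replaces the entropy of [g] by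
   [ln (Zpart b2)] minus [b2] times its mean energy, whence the factor [b3 - b2]. *)
have := @gibbs_le R O P (fun x => b3 * E x) (fun x => ltW (P0 x)) P1.
rewrite -/(Zpart b3); under [X in _ + X <= _ -> _]eq_bigr do rewrite mulrCA.
rewrite -mulr_sumr; have := gibbs_entropy b2; rewrite -/g; lra.
Qed.

End StrictConvexity.

(** * States on cylinder functions *)

Section States.
Variables (d : nat) (A : finType) (R : realType).
Local Notation config := (Zd d -> A).
Implicit Types (L : {fset Zd d}) (x y : config) (v : Zd d).

Definition agree L x y := forall i, i \in L -> x i = y i.

Definition cylf (T : Type) (f : config -> T) :=
  exists L, forall x y, agree L x y -> f x = f y.

Lemma agreeS L L' x y : (L `<=` L')%fset -> agree L' x y -> agree L x y.
Proof. by move=> /fsubsetP LL' xy i /LL'; exact: xy. Qed.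

Lemma cylf_cst T (c : T) : cylf (fun=> c).
Proof. by exists fset0. Qed.

Lemma cylf_comp2 T1 T2 T (h : T1 -> T2 -> T) f g :
  cylf f -> cylf g -> cylf (fun x => h (f x) (g x)).
Proof.
move=> [L Lf] [L' Lg]; exists (L `|` L')%fset => x y xy.
by rewrite (Lf x y) ?(Lg x y) //; apply: agreeS xy; rewrite ?fsubsetUl ?fsubsetUr.
Qed.

Lemma cylf_comp T1 T (h : T1 -> T) f : cylf f -> cylf (fun x => h (f x)).
Proof. by move=> [L Lf]; exists L => x y xy; rewrite (Lf x y). Qed.

Lemma cylf_sum (I : Type) (r : seq I) (F : I -> config -> R) :
  (forall i, cylf (F i)) -> cylf (fun x => \sum_(i <- r) F i x).
Proof.
move=> HF; elim: r => [|i r IH].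
  by have [L H] := cylf_cst (0 : R); exists L => x y xy; rewrite !big_nil.
have [L H] := cylf_comp2 +%R (HF i) IH.
by exists L => x y xy; rewrite !big_cons; exact: H.
Qed.

Definition trans v L : {fset Zd d} := [fset (i + v)%R | i in L]%fset.

Lemma in_trans v L i : (i \in trans v L) = (i - v \in L).
Proof.
apply/imfsetP/idP => [[j /= jL ->]|iL]; first by rewrite addrK.
by exists (i - v); rewrite //= subrK.
Qed.

Lemma card_trans v L : #|` trans v L| = #|` L|.
Proof. by rewrite card_imfset //=; exact: addIr. Qed.

Lemma agree_shift v L x y :
  agree (trans v L) x y -> agree L (Defs.shift v x) (Defs.shift v y).
Proof. by move=> xy i iL; apply: xy; rewrite in_trans addrK. Qed.

Lemma cylf_shift T v (f : config -> T) : cylf f -> cylf (fun x => f (Defs.shift v x)).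
Proof.
by move=> [L Lf]; exists (trans v L) => x y /agree_shift xy; exact: Lf.
Qed.

(* A finitely additive probability on cylinder events, given by its expectation
   functional. The functional is total, but nothing is required outside of
   cylinder functions. *)
Record state (m : (config -> R) -> R) : Prop := State {
  state1 : m (fun=> 1) = 1;
  state_ge0 : forall f, cylf f -> (forall x, 0 <= f x) -> 0 <= m f;
  state_linear : forall c f g, cylf f -> cylf g ->
    m (fun x => c * f x + g x) = c * m f + m g }.

Definition invariant (m : (config -> R) -> R) :=
  forall v f, cylf f -> m (fun x => f (Defs.shift v x)) = m f.

Section OneState.
Variables (m : (config -> R) -> R) (ms : state m).

Lemma stateZ c f : cylf f -> m (fun x => c * f x) = c * m f.
Proof.
move=> cf; have m0 : m (fun=> 0) = 0.
  have := state_linear ms 1 (cylf_cst 0) (cylf_cst 0).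
  by rewrite (_ : (fun=> _) = fun=> 0); [lra | apply/funext => x; lra].
rewrite -[RHS]addr0 -m0 -(state_linear ms) //; last exact: cylf_cst.
by congr (m _); apply/funext => x; rewrite addr0.
Qed.

Lemma stateD f g : cylf f -> cylf g -> m (fun x => f x + g x) = m f + m g.
Proof.
move=> cf cg; rewrite -[m f]mul1r -(state_linear ms) //.
by congr (m _); apply/funext => x; rewrite mul1r.
Qed.

Lemma state_cst c : m (fun=> c) = c.
Proof.
rewrite -[RHS]mulr1 -(state1 ms) -stateZ; last exact: cylf_cst.
by congr (m _); apply/funext => x; rewrite mulr1.
Qed.

Lemma state_sum (I : Type) (r : seq I) (F : I -> config -> R) :
  (forall i, cylf (F i)) ->
  m (fun x => \sum_(i <- r) F i x) = \sum_(i <- r) m (F i).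
Proof.
move=> HF; elim: r => [|i r IH].
  rewrite big_nil -[RHS](state_cst 0); congr (m _); apply/funext => x.
  by rewrite big_nil.
rewrite big_cons -IH -stateD //; last exact: cylf_sum.
by congr (m _); apply/funext => x; rewrite big_cons.
Qed.

Lemma state_le f g : cylf f -> cylf g -> (forall x, f x <= g x) -> m f <= m g.
Proof.
move=> cf cg fg; rewrite -subr_ge0 -mulN1r addrC -(state_linear ms) //.
apply: (state_ge0 ms) => [|x]; last by rewrite mulN1r addrC subr_ge0.
exact: (cylf_comp2 (fun a b => -1 * a + b)).
Qed.

Definition prob (S : finType) (f : config -> S) (s : S) := m (fun x => (f x == s)%:R).
Definition ent (S : finType) (f : config -> S) := \sum_s eta (prob f s).

Lemma cylf_eq (S : finType) (f : config -> S) s :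
  cylf f -> cylf (fun x => (f x == s)%:R : R).
Proof. by move=> cf; exact: (cylf_comp (fun a => (a == s)%:R)). Qed.

Lemma prob_ge0 (S : finType) (f : config -> S) s : cylf f -> 0 <= prob f s.
Proof. by move=> cf; apply: (state_ge0 ms) => //; exact: cylf_eq. Qed.

Lemma state_partition (S : finType) (f : config -> S) g : cylf f -> cylf g ->
  m g = \sum_s m (fun x => g x * (f x == s)%:R).
Proof.
move=> cf cg; rewrite -state_sum => [|s]; last first.
  exact: (cylf_comp2 *%R cg (cylf_eq _ _)).
congr (m _); apply/funext => x; rewrite (bigD1 (f x)) //= eqxx mulr1.
by rewrite big1 ?addr0 // => s; rewrite eq_sym => /negPf ->; rewrite mulr0.
Qed.

Lemma prob_sum (S : finType) (f : config -> S) : cylf f -> \sum_s prob f s = 1.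
Proof.
move=> cf; rewrite -(state1 ms) (state_partition cf (cylf_cst 1)).
by apply: eq_bigr => s _; congr (m _); apply/funext => x; rewrite mul1r.
Qed.

Lemma prob_le1 (S : finType) (f : config -> S) s : cylf f -> prob f s <= 1.
Proof.
move=> cf; rewrite -(prob_sum cf) (bigD1 s) //= lerDl.
by apply: sumr_ge0 => t _; exact: prob_ge0.
Qed.

Lemma ent_ge0 (S : finType) (f : config -> S) : cylf f -> 0 <= ent f.
Proof.
by move=> cf; apply: sumr_ge0 => s _; apply: eta_ge0; [exact: prob_ge0|exact: prob_le1].
Qed.

Lemma ent_le_ln_card (S : finType) (f : config -> S) : cylf f -> ent f <= ln #|S|%:R.
Proof.
move=> cf; apply: sum_eta_le_ln_card; last exact: prob_sum.
by move=> s; exact: prob_ge0.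
Qed.

Lemma prob_pair (S T : finType) (f : config -> S) (g : config -> T) s t :
  prob (fun x => (f x, g x)) (s, t) = m (fun x => (f x == s)%:R * (g x == t)%:R).
Proof. by congr (m _); apply/funext => x; rewrite xpair_eqE -natrM mulnb. Qed.

Lemma prob_marg (S T : finType) (f : config -> S) (g : config -> T) s :
  cylf f -> cylf g -> prob f s = \sum_t prob (fun x => (f x, g x)) (s, t).
Proof.
move=> cf cg; rewrite /prob (state_partition cg (cylf_eq s cf)).
by apply: eq_bigr => t _; rewrite -prob_pair.
Qed.

(** Both entropies are compared with that of the pair: a marginal has smaller entropy, and given a
    value [t] of [g] only one [s] carries joint mass, so the pair has no more entropy than [g]. *)
Lemma ent_le_determined (S T : finType) (f : config -> S) (g : config -> T) :
  cylf f -> cylf g -> (forall x y, g x = g y -> f x = f y) -> ent f <= ent g.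
Proof.
move=> cf cg gf.
have cfg : cylf (fun x => (f x, g x)) by exact: (cylf_comp2 pair).
apply: (@le_trans _ _ (\sum_s \sum_t eta (prob (fun x => (f x, g x)) (s, t)))).
  apply: ler_sum => s _; rewrite (prob_marg s cf cg); apply: eta_sum_le => t.
  exact: prob_ge0.
rewrite exchange_big; apply: ler_sum => t _ /=.
have [[x gx]|nx] := pselect (exists x, g x = t); last first.
  have z h : (forall x, h x * (g x == t)%:R = 0) -> m (fun x => h x * (g x == t)%:R) = 0.
    by move=> h0; rewrite -[RHS](state_cst 0); congr (m _); apply/funext.
  rewrite big1; first by apply: eta_ge0; [exact: prob_ge0|exact: prob_le1].
  move=> s _; rewrite prob_pair z ?eta0 // => x.
  by case: (g x =P t) => [gx|_]; [case: nx; exists x|rewrite mulr0].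
rewrite (bigD1 (f x)) //= big1 => [|s sf].
  rewrite addr0 (_ : prob _ (f x, t) = prob g t) // prob_pair; congr (m _).
  apply/funext => y; case: (g y =P t) => [gy|_]; last by rewrite mulr0.
  by rewrite (gf y x) ?gy ?gx // eqxx mulr1.
rewrite prob_pair (_ : (fun y => _) = fun=> 0) ?state_cst ?eta0 //.
apply/funext => y; case: (g y =P t) => [gy|_]; last by rewrite mulr0.
by rewrite (gf y x) ?gy ?gx // eq_sym (negPf sf) mul0r.
Qed.

Lemma ent_submodular (S T U : finType) (f : config -> S) (g : config -> T)
  (k : config -> U) : cylf f -> cylf g -> cylf k ->
  ent (fun x => (f x, (g x, k x))) + ent k <=
  ent (fun x => (f x, k x)) + ent (fun x => (g x, k x)).
Proof.
move=> cf cg ck.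
have cgk : cylf (fun x => (g x, k x)) by exact: (cylf_comp2 pair).
have cfk : cylf (fun x => (f x, k x)) by exact: (cylf_comp2 pair).
have cfgk : cylf (fun x => (f x, (g x, k x))) by exact: (cylf_comp2 pair).
pose w s t u := prob (fun x => (f x, (g x, k x))) (s, (t, u)).
have := @eta_submodular R S T U w (fun s t u => prob_ge0 _ cfgk).
have wE s t u : w s t u =
   m (fun x => (f x == s)%:R * ((g x == t)%:R * (k x == u)%:R)).
  rewrite /w prob_pair; congr (m _); apply/funext => x; congr (_ * _).
  by rewrite xpair_eqE -natrM mulnb.
have E1 s u : \sum_t w s t u = prob (fun x => (f x, k x)) (s, u).
  rewrite (prob_marg _ cfk cg); apply: eq_bigr => t _; rewrite wE prob_pair.
  congr (m _); apply/funext => x; rewrite xpair_eqE -[in RHS]mulnb natrM.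
  by rewrite mulrA mulrAC.
have E2 t u : \sum_s w s t u = prob (fun x => (g x, k x)) (t, u).
  rewrite (prob_marg _ cgk cf); apply: eq_bigr => s _; rewrite /w !prob_pair.
  by congr (m _); apply/funext => x; rewrite mulrC.
have E3 u : \sum_s \sum_t w s t u = prob k u.
  under eq_bigr do rewrite E1.
  rewrite (prob_marg _ ck cf); apply: eq_bigr => s _; rewrite !prob_pair.
  by congr (m _); apply/funext => x; rewrite mulrC.
under [X in _ + X <= _ -> _]eq_bigr do rewrite E3.
under [X in _ <= X + _ -> _]eq_bigr do under eq_bigr do rewrite E1.
under [X in _ <= _ + X -> _]eq_bigr do under eq_bigr do rewrite E2.
have -> : \sum_s \sum_t \sum_u eta (w s t u) =
    ent (fun x => (f x, (g x, k x))).
  under eq_bigr do rewrite pair_bigA /=; rewrite pair_bigA /=.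
  by apply: eq_bigr => -[s [t u]] _.
rewrite !pair_bigA /=.
move=> H; apply: le_trans H _; apply: lerD.
  by apply: ler_sum => -[s u] _.
by apply: ler_sum => -[s u] _.
Qed.

Definition res L x : {ffun L -> A} := [ffun i => x (val i)].

Lemma res_eqP L x y : res L x = res L y <-> agree L x y.
Proof.
split=> [/ffunP H i iL|H].
  by have := H [` iL]%fset; rewrite !ffunE.
by apply/ffunP => i; rewrite !ffunE H // (valP i).
Qed.

Lemma cylf_res L : cylf (res L).
Proof. by exists L => x y /res_eqP. Qed.

Definition Hs L := ent (res L).

Lemma HsS L L' : (L `<=` L')%fset -> Hs L <= Hs L'.
Proof.
move=> LL'; apply: ent_le_determined; [exact: cylf_res..|].
by move=> x y /res_eqP/(agreeS LL')/res_eqP.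
Qed.

(** Strong subadditivity for the letter at [i], the pattern on [L'] and the pattern on [L], the last
    being a function of the second. *)
Lemma Hs_submodular L L' i : (L `<=` L')%fset ->
  Hs (i |` L')%fset + Hs L <= Hs (i |` L)%fset + Hs L'.
Proof.
move=> LL'; have ci : cylf (fun x => x i).
  by exists [fset i]%fset => x y; apply; rewrite inE.
have [cL cL'] := (cylf_res L, cylf_res L').
have agU K x y : agree (i |` K)%fset x y <-> x i = y i /\ agree K x y.
  split=> [H|[xi H] j]; first by split=> [|j jK]; apply: H; rewrite !inE ?eqxx ?jK ?orbT.
  by rewrite !inE => /predU1P[->|/H].
apply: le_trans (le_trans (ent_submodular ci cL' cL) _).
  rewrite lerD2r; apply: ent_le_determined; first exact: cylf_res.
    exact: (cylf_comp2 pair ci (cylf_comp2 pair _ _)).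
  by move=> x y [xi /res_eqP H _]; apply/res_eqP/agU.
apply: lerD; apply: ent_le_determined; do ?[exact: cylf_res];
  do ?[by apply: (cylf_comp2 pair)].
  by move=> x y /res_eqP/agU[-> /res_eqP ->].
by move=> x y E; rewrite E; congr pair; apply/res_eqP/(agreeS LL')/res_eqP.
Qed.

Lemma Hs_le_card L : Hs L <= #|` L|%:R * ln #|A|%:R.
Proof.
apply: le_trans (ent_le_ln_card (cylf_res L)) _.
rewrite card_ffun -cardfE natrX.
(* For an empty alphabet the convention [ln 0 = 0] makes the right side 0, while the left side is
   [ln] of a number at most 1. *)
have [->|A0] := eqVneq #|A| 0%N; last by rewrite lnXn ?mulr_natl // ltr0n lt0n.
by rewrite (ln0 (x := 0%:R)) // mulr0 ln_le0 // exprn_ile1.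
Qed.

Lemma Hs_ge0 L : 0 <= Hs L. Proof. exact/ent_ge0/cylf_res. Qed.

Lemma Hs0 : Hs fset0 = 0.
Proof.
apply/eqP; rewrite eq_le Hs_ge0 andbT; apply: le_trans (Hs_le_card _) _.
by rewrite cardfs0 mul0r.
Qed.

(** Shearer's inequality, by removing one site [e] of [B] at a time. By submodularity every [S k]
    containing [e] gains at least [Hs B - Hs B'] when [e] is put back, and at least [t] of them
    contain it. *)
Lemma shearer (I : Type) (V : seq I) (S : I -> {fset Zd d}) (B : {fset Zd d}) t :
  (forall i, i \in B -> (t <= count (fun k => i \in S k) V)%N) ->
  t%:R * Hs B <= \sum_(k <- V) Hs (S k).
Proof.
move=> cov; apply: (@le_trans _ _ (\sum_(k <- V) Hs (S k `&` B)%fset)); last first.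
  by apply: ler_sum => k _; apply: HsS; exact: fsubsetIl.
elim/finSet_rect: B cov => B IH cov.
have [->|/fset0Pn[e eB]] := eqVneq B fset0.
  by rewrite Hs0 mulr0; apply: sumr_ge0 => k _; exact: Hs_ge0.
set B' := (B `\ e)%fset; have BE : B = (e |` B')%fset by rewrite fsetD1K.
have := IH B' (fproperD1 eB); set l := (_ * _) => IH'.
have {}IH : l <= \sum_(k <- V) Hs (S k `&` B')%fset.
  by apply: IH' => i; rewrite !inE => /andP[_ iB]; exact: cov.
have step k : Hs (S k `&` B')%fset + (e \in S k)%:R * (Hs B - Hs B') <=
    Hs (S k `&` B)%fset.
  have := @Hs_submodular (S k `&` B')%fset B' e (fsubsetIr _ _).
  have [eS|eS] := boolP (e \in S k); rewrite -BE => H.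
    have -> : (S k `&` B = e |` (S k `&` B'))%fset.
      by rewrite {1}BE fsetIUr (fsetIidPr _) ?fsub1set.
    by rewrite mul1r; lra.
  by rewrite mul0r addr0; apply: HsS; apply: fsetIS; exact: fsubsetDl.
apply: le_trans (ler_sum _ (fun k _ => step k)).
rewrite big_split /= -mulr_suml.
have -> : \sum_(k <- V) (e \in S k)%:R = (count (fun k => e \in S k) V)%:R :> R.
  by rewrite -sum1_count natr_sum [RHS]big_mkcond; apply: eq_bigr => k _; case: ifP.
have BB' : Hs B' <= Hs B by apply: HsS; exact: fsubsetDl.
have : t%:R * (Hs B - Hs B') <= (count (fun k => e \in S k) V)%:R * (Hs B - Hs B').
  by rewrite ler_wpM2r ?subr_ge0 // ler_nat cov.
move: IH; rewrite /l; lra.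
Qed.

End OneState.
End States.

(** * Boxes and covering inequalities *)

Section Boxes.
Variable d : nat.

Definition box n : {fset Zd d} :=
  [fset @boxpt d n k | k in {ffun 'I_d -> 'I_(n.*2.+1)}]%fset.

Lemma in_box n (i : Zd d) : (i \in box n) = [forall j, (`|i 0%R j|%N <= n)%N].
Proof.
apply/imfsetP/forallP => [[k _ -> j]|H].
  by rewrite mxE; move: (ltn_ord (k j)); move: (nat_of_ord _) => a h; lia.
have Hk j : (`|(i 0%R j + n%:Z)%R|%N < n.*2.+1)%N by have h := H j; lia.
exists [ffun j => Ordinal (Hk j)] => //=.
by apply/rowP => j; rewrite mxE ffunE /=; have h := H j; lia.
Qed.

Lemma boxpt_inj n : injective (@boxpt d n).
Proof.
move=> k l /rowP kl; apply/ffunP => j; apply/val_inj => /=.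
by have := kl j; rewrite !mxE => h; lia.
Qed.

Lemma card_box n : #|` box n| = (n.*2.+1 ^ d)%N.
Proof.
rewrite card_imfset /=; last exact: boxpt_inj.
by rewrite -cardE card_ffun !card_ord.
Qed.

Lemma box_sub m n : (m <= n)%N -> (box m `<=` box n)%fset.
Proof.
move=> mn; apply/fsubsetP => i; rewrite !in_box => /forallP H.
by apply/forallP => j; exact: leq_trans (H j) mn.
Qed.

Lemma in_boxD m n i j : i \in box m -> j \in box n -> i + j \in box (m + n).
Proof.
rewrite !in_box => /forallP H /forallP K; apply/forallP => l; rewrite mxE.
by move: (i 0%R l) (j 0%R l) (H l) (K l) => a b h h'; lia.
Qed.

Lemma in_boxN m i : (- i \in box m) = (i \in box m).
Proof. by rewrite !in_box; apply: eq_forallb => l; rewrite mxE abszN. Qed.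

Lemma in_boxB m n i j : i \in box m -> j \in box n -> i - j \in box (m + n).
Proof. by move=> im jn; rewrite in_boxD // in_boxN. Qed.

Lemma box_gt0 n : (0 < #|` box n|)%N.
Proof. by rewrite card_box expn_gt0. Qed.

Lemma sub_box_ex (L : {fset Zd d}) : exists n, (L `<=` box n)%fset.
Proof.
exists (\max_(i <- L) \max_j `|(i : Zd d) 0%R j|%N)%N.
apply/fsubsetP => i iL; rewrite in_box; apply/forallP => j.
apply: leq_trans (leq_bigmax_seq (F := fun i : Zd d => (\max_j `|i 0%R j|%N)%N) _ iL isT).
exact: (leq_bigmax (F := fun j => `|i 0%R j|%N)).
Qed.

Lemma box_cover k N i : i \in box N ->
  (#|` box k| <= count (fun v => i \in trans v (box k)) (box (N + k)))%N.
Proof.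
move=> iN; rewrite -size_filter -(size_map (fun j => i - j)).
apply: uniq_leq_size => [|_ /mapP[j jk ->]].
  by rewrite map_inj_uniq ?fset_uniq // => a b /addrI/oppr_inj.
by rewrite mem_filter in_trans subKr jk /= in_boxB.
Qed.

End Boxes.

Section BoxEntropy.
Variables (d : nat) (A : finType) (R : realType).
Variables (m : ((Zd d -> A) -> R) -> R) (ms : state m).
Local Notation box := (box d).

(** Shearer with the translates of [box k] centred in [box (N + k)]; centres outside [box N] get the
    trivial bound by [ln #|A|]. The translates stay in the sum because the inequality is also
    applied to finite-volume Gibbs states, which are not invariant. *)
Lemma entropy_box_cover k N :
  #|` box k|%:R * Hs m (box N) <= \sum_(v <- box N) Hs m (trans v (box k))
   + (#|` box (N + k)|%:R - #|` box N|%:R) * (#|` box k|%:R * ln #|A|%:R).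
Proof.
apply: le_trans (shearer ms (@box_cover d k N)) _.
have sub : (box N `<=` box (N + k))%fset by apply: box_sub; exact: leq_addr.
rewrite (big_fsetID _ (mem (box N))) /=.
rewrite [X in X + _ <= _](_ : _ = \sum_(v <- box N) Hs m (trans v (box k))); last first.
  by apply: eq_fbigl => v; rewrite !inE /=; case: (boolP (v \in box N));
    rewrite ?andbF ?andbT // => /(fsubsetP sub).
rewrite lerD2l.
have -> : #|` box (N + k)|%:R - #|` box N|%:R =
   #|` [fset x in box (N + k) | x \notin box N]%fset|%:R :> R.
  rewrite -natrB ?fsubset_leq_card // -cardfsDS //; congr (_%:R).
  by congr #|` _|; apply/fsetP => v; rewrite !inE /= andbC.
apply: (@le_trans _ _ (\sum_(v <- [fset x in box (N + k) | x \notin box N]%fset)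
   (#|` box k|%:R * ln #|A|%:R))).
  by apply: ler_sum => v _; rewrite -(card_trans v); exact: Hs_le_card.
by rewrite big_const_seq count_predT iter_addr_0 [leRHS]mulr_natl.
Qed.

Lemma Hs_trans v L : invariant m -> Hs m (trans v L) = Hs m L.
Proof.
move=> inv; apply/eqP; rewrite eq_le.
have E : Hs m L = ent m (fun x => res L (Defs.shift v x)).
  by apply: eq_bigr => s _; congr eta; rewrite /prob -(inv v _ (cylf_eq R s (@cylf_res d A L))).
have c := cylf_shift v (@cylf_res d A L).
rewrite E; apply/andP; split; apply: ent_le_determined => //;
  do ?[exact: cylf_res]; move=> x y; rewrite !res_eqP; last exact: agree_shift.
move=> H i; rewrite in_trans => iL; have := H _ iL.
by rewrite /Defs.shift subrK.
Qed.

End BoxEntropy.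

Section Ratio.
Variables (d : nat) (R : realType).
Local Notation box := (box d).

Lemma card_box_ratio k :
  (fun N => #|` box (N + k)|%:R / #|` box N|%:R : R) @ \oo --> (1 : R).
Proof.
have r1 : (fun N => 1 + (k.*2)%:R / (N.*2.+1)%:R : R) @ \oo --> (1 : R).
  rewrite -[X in _ --> X]addr0; apply: cvgD; first exact: cvg_cst.
  rewrite -(mulr0 (k.*2)%:R); apply: cvgMl_tmp.
  apply/cvgrPdist_lt => e e0; near=> N.
  rewrite sub0r normrN ger0_norm ?invr_ge0 //.
  rewrite invf_plt ?posrE // -[ltLHS]ger0_norm ?invr_ge0 ?(ltW e0) //.
  apply: (@lt_le_trans _ _ N%:R); last by rewrite ler_nat; lia.
  near: N; exact: nbhs_infty_gtr.
have -> : (fun N => #|` box (N + k)|%:R / #|` box N|%:R : R) =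
    (fun N => (1 + (k.*2)%:R / (N.*2.+1)%:R) ^+ d).
  apply/funext => N; rewrite !card_box !natrX -expr_div_n; congr (_ ^+ _).
  by rewrite doubleD -addSn natrD mulrDl divff //.
rewrite -[X in _ --> X](expr1n R d).
exact: (continuous_cvg _ (@exprn_continuous R d 1) r1).
Unshelve. all: by end_near. Qed.
End Ratio.

(** * Kolmogorov extension *)

Section CylinderAlgebra.
Variables (d : nat) (A : finType) (a0 : A) (R : realType).
Local Notation config := (Zd d -> A).

(** A copy of the configuration space whose measurable sets are the cylinder events alone: an
    algebra of sets on which the Caratheodory extension can start. *)
Definition cylT : Type := Zd d -> ptA a0.
HB.instance Definition _ := gen_eqMixin cylT.
HB.instance Definition _ := gen_choiceMixin cylT.
HB.instance Definition _ := isPointed.Build cylT (fun=> a0).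

Definition cyle (B : set config) : Prop := cylf (B : config -> Prop).

Lemma cyle_fiber T (f : config -> T) (Q : set T) : cylf f -> cyle (f @^-1` Q).
Proof. exact: cylf_comp. Qed.

Lemma cyle0 : cyle set0. Proof. exact: cylf_cst. Qed.

Lemma cyleU : setU_closed cyle.
Proof. by move=> B C cB cC; exact: (cylf_comp2 or). Qed.

Lemma cyleC : setC_closed cyle.
Proof. by move=> B cB; exact: (cylf_comp not). Qed.

Lemma cyleI : setI_closed cyle.
Proof. by move=> B C cB cC; exact: (cylf_comp2 and). Qed.

HB.instance Definition _ :=
  @isAlgebraOfSets.Build default_measure_display cylT cyle cyle0 cyleU cyleC.

Lemma cylf_indic (B : set config) : cyle B -> cylf (\1_B : config -> R).
Proof.
by move=> cB; exact: (cylf_comp (fun P : Prop => (`[< P >])%:R : R)).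
Qed.

(** Compactness of the full shift. Otherwise for every [N] some [x N] in [B] avoids the first [N]
    sets. Along an ultrafilter every site has an eventually constant letter, [A] being finite; the
    resulting [y] lies in [B] but in no [F i], as membership depends on finitely many sites. *)
Lemma cyle_compact (B : set config) (F : nat -> set config) :
  cyle B -> (forall i, cyle (F i)) -> B `<=` \bigcup_i F i ->
  exists N, forall x, B x -> exists2 i, (i < N)%N & F i x.
Proof.
move=> cB cF BF; apply: contrapT => /forallNP H.
have /choice[x xP] N : exists x, B x /\ forall i, (i < N)%N -> ~ F i x.
  apply: contrapT => nx; apply: (H N) => x Bx; apply: contrapT => nF.
  by apply: nx; exists x; split=> // i iN Fi; apply: nF; exists i.
have [U [UU oU]] := ultraFilterLemma eventually_filter.
have PU := @ultra_proper _ _ UU.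
have /choice[y yP] v : exists a, \forall N \near U, x N v = a.
  apply: contrapT => /forallNP na.
  have : \forall N \near U, forall a : A, x N v <> a.
    apply: filter_forall => a.
    have [h|//] := in_ultra_setVsetC [set N | x N v = a] UU.
    by case: (na a).
  by move=> /filter_ex[N /(_ (x N v))].
have agr L : \forall N \near U, agree L (x N) y.
  have : \forall N \near U, forall i : L, x N (val i) = y (val i).
    by apply: filter_forall => i; exact: yP.
  by apply: filterS => N h i iL; exact: (h [` iL]%fset).
have By : B y.
  have [L Lf] := cB; have [N h] := filter_ex (agr L).
  by rewrite -(Lf _ _ h); exact: (xP N).1.
have [i _ Fi] := BF _ By; have [L Lf] := cF i.
have : \forall N \near U, agree L (x N) y /\ (i < N)%N.
  by apply: filterI; [exact: agr|apply: oU; exact: nbhs_infty_gt].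
by move=> /filter_ex[N [h iN]]; apply: (xP N).2 iN _; rewrite (Lf _ _ h).
Qed.

Section Extension.
Variables (m : (config -> R) -> R) (ms : state m).

(** The maximum with 0 makes the value nonnegative on every set, as nothing is known of [m] off
    cylinder functions. The argument [state m] lets the measure instance carry the proof it depends
    on. *)
Definition premeasure of state m : set cylT -> \bar R :=
  fun B => (Num.max 0 (m (\1_(B : set config))))%:E.
Let mu := premeasure ms.

Lemma premeasureE (B : set config) : cyle B -> mu B = (m \1_B)%:E.
Proof.
move=> cB; rewrite /mu /premeasure max_r //.
by apply: (state_ge0 ms) => //; exact: cylf_indic.
Qed.

Let mu0 : mu set0 = 0%E.
Proof.
rewrite premeasureE; last exact: cyle0.
by rewrite indic0 (state_cst ms).
Qed.

Let mu_ge0 B : (0 <= mu B)%E.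
Proof. by rewrite /mu /premeasure lee_fin le_max lexx. Qed.

Let mu_sigma_additive : semi_sigma_additive mu.
Proof.
move=> F mF tF mUF.
(* By compactness a countable union that is a cylinder event is already the union of its first [N]
   members: the partial sums are eventually constant, and finite additivity is enough. *)
have [N FN] := cyle_compact mUF mF (@subset_refl _ _).
apply: cvg_near_cst; exists N => // n /= Nn; rewrite premeasureE //.
under eq_bigr => i _ do rewrite (premeasureE (mF i)).
rewrite sumEFin -(state_sum ms) => [|i]; last exact/cylf_indic/mF.
congr (_%:E); congr (m _); apply/funext => x; rewrite indicE.
have [/set_mem UFx|nUFx] := boolP (x \in \bigcup_n0 F n0).
  have [i iN Fi] := FN _ UFx.
  rewrite (bigD1_seq i) /= ?mem_index_iota ?iota_uniq ?(leq_trans iN) //.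
  rewrite indicE mem_set // big1 ?addr0 // => j ji.
  rewrite indicE memNset // => Fj; move/trivIsetP : tF => /(_ _ _ I I ji).
  by move/seteqP => [+ _]; apply; split; [exact: Fj|exact: Fi].
rewrite big1 // => i _; rewrite indicE memNset // => Fi.
by move: nUFx; rewrite mem_set //; exists i.
Qed.

HB.instance Definition _ := isMeasure.Build _ _ _ mu mu0 mu_ge0 mu_sigma_additive.

Lemma sub_cyl_measurable (B : set (X d a0)) : measurable B ->
  @measurable _ (g_sigma_algebraType (@measurable _ cylT)) B.
Proof.
apply: smallest_sub; first exact: smallest_sigma_algebra.
move=> C [L [w ->]]; apply: sub_sigma_algebra.
exists L => x y xy; apply/propext; split=> H i iL.
  by rewrite -(xy i iL) H.
by rewrite (xy i iL) H.
Qed.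

Definition state_measure of state m : set (X d a0) -> \bar R :=
  fun B => measure_extension mu B.

Let nu := state_measure ms.

Let nu0 : nu set0 = 0%E. Proof. exact: measure0. Qed.
Let nu_ge0 B : (0 <= nu B)%E. Proof. exact: measure_ge0. Qed.
Let nu_sigma_additive : semi_sigma_additive nu.
Proof.
move=> F mF tF mUF; apply: measure_semi_sigma_additive => //.
  by move=> i; exact: sub_cyl_measurable.
exact: sub_cyl_measurable.
Qed.

HB.instance Definition _ := isMeasure.Build _ _ _ nu nu0 nu_ge0 nu_sigma_additive.

Lemma state_measureE (B : set config) : cyle B -> nu B = (m \1_B)%:E.
Proof.
move=> cB; rewrite /nu /state_measure /measure_extension.
rewrite measurable_mu_extE //; exact: premeasureE.
Qed.

Let nuT : nu setT = 1%E.
Proof.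
rewrite state_measureE; last exact: cylf_cst.
by rewrite indicT (state1 ms).
Qed.

HB.instance Definition _ := Measure_isProbability.Build _ _ _ nu nuT.

Lemma state_extension : exists P : probability (X d a0) R,
  forall B : set config, cyle B -> P B = (m \1_B)%:E.
Proof. by exists nu; exact: state_measureE. Qed.

End Extension.
End CylinderAlgebra.

(** * Expectation functionals of probability measures *)

Section ProbabilityState.
Variables (d : nat) (A : finType) (a0 : A) (R : realType).
Local Notation config := (Zd d -> A).
Implicit Types (f g : config -> R) (L : {fset Zd d}).

Definition extL L (q : {ffun L -> A}) : config :=
  fun i => oapp q a0 (insub i).

Lemma extL_res L x : agree L (extL (res L x)) x.
Proof. by move=> i iL; rewrite /extL insubT /= ffunE. Qed.

Lemma res_extL L q : res L (extL q) = q.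
Proof.
apply/ffunP => i; rewrite ffunE /extL insubT ?(valP i) //= => iL.
by congr (q _); apply/val_inj.
Qed.

Lemma cylf_expand L f : (forall x y, agree L x y -> f x = f y) ->
  f = fun x => \sum_q f (extL q) * (res L x == q)%:R.
Proof.
move=> Lf; apply/funext => x; rewrite (bigD1 (res L x)) //= eqxx mulr1.
rewrite big1 ?addr0 => [|q]; first by apply: Lf => i iL; rewrite extL_res.
by rewrite eq_sym => /negPf ->; rewrite mulr0.
Qed.

Lemma state_expand (m : (config -> R) -> R) L f : state m ->
  (forall x y, agree L x y -> f x = f y) ->
  m f = \sum_q f (extL q) * prob m (res L) q.
Proof.
move=> ms Lf; rewrite {1}(cylf_expand Lf) (state_sum ms) => [|q].
  apply: eq_bigr => q _; rewrite (stateZ ms) //.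
  exact/cylf_eq/cylf_res.
exact: (cylf_comp (fun b => f (extL q) * b) (cylf_eq R q (@cylf_res d A L))).
Qed.

Lemma cylf_bounded f : cylf f -> exists M, forall x, `|f x| <= M.
Proof.
move=> [L Lf]; exists (\sum_(q : {ffun L -> A}) `|f (extL q)| : R) => x.
rewrite (Lf x (extL (res L x))); last by move=> i iL; rewrite extL_res.
by rewrite (bigD1 (res L x)) //= lerDl sumr_ge0.
Qed.

Lemma cyle_measurable (B : set config) : cyle B -> measurable (B : set (X d a0)).
Proof.
move=> [L Lf].
have -> : B = \bigcup_(q in [set q : {ffun L -> A} | B (extL q)]) (cyl L (extL q)).
  apply/seteqP; split=> [x Bx|x [q /= Bq H]].
    exists (res L x) => /=; last by move=> i iL; rewrite extL_res.
    by rewrite (Lf _ x) //; exact: extL_res.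
  by rewrite (Lf _ (extL q)).
apply: fin_bigcup_measurable => [|q _]; first exact: finite_finset.
by apply: sub_sigma_algebra; exists L, (extL q).
Qed.

Lemma cylf_measurable f : cylf f -> measurable_fun setT (f : X d a0 -> R).
Proof.
move=> cf _ Y _; rewrite setTI; apply: cyle_measurable; exact: cyle_fiber.
Qed.

Section OneProbability.
Variable mu : probability (X d a0) R.

Definition Em f : R := \int[mu]_x f x.

Lemma cylf_integrable f : cylf f -> mu.-integrable setT (EFin \o (f : X d a0 -> R)).
Proof.
move=> cf; apply: measurable_bounded_integrable => //.
- by rewrite (le_lt_trans (probability_le1 _ _)) ?ltry.
- exact: cylf_measurable.
have [M HM] := cylf_bounded cf.
exists M; split; first by rewrite num_real.
by move=> K MK x _ /=; apply: le_trans (HM x) (ltW MK).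
Qed.

Lemma Em_indic (B : set config) : cyle B -> Em \1_B = fine (mu B).
Proof.
by move=> cB; rewrite /Em /Rintegral integral_indic ?setIT //; exact: cyle_measurable.
Qed.

Lemma Em_state : state Em.
Proof.
split.
- rewrite (_ : (fun=> 1) = \1_[set: config]) ?indicT // -indicT Em_indic.
    by rewrite probability_setT.
  exact: cylf_cst.
- by move=> f cf f0; apply: Rintegral_ge0.
move=> c f g cf cg; rewrite /Em RintegralD //.
- by congr (_ + _); rewrite RintegralZl //; exact: cylf_integrable.
- exact: (cylf_integrable (cylf_comp ( *%R c) cf)).
- exact: cylf_integrable.
Qed.

Lemma prob_Em (S : finType) (f : config -> S) s : cylf f ->
  prob Em f s = fine (mu [set x | f x = s]).
Proof.
move=> cf; rewrite -Em_indic; last exact: (cyle_fiber [set s]).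
congr Em; apply/funext => x; rewrite indicE; congr (_%:R).
by congr nat_of_bool; apply/eqP/idP => [?|/set_mem]; rewrite ?inE.
Qed.

Lemma invariant_Em : shift_invariant mu -> invariant Em.
Proof.
move=> inv v f [L Lf]; rewrite (state_expand Em_state Lf).
have cq (q : {ffun L -> A}) : cylf (fun x => (res L x == q)%:R : R) by exact/cylf_eq/cylf_res.
have -> : (fun x => f (Defs.shift v x)) =
    fun x => \sum_q f (extL q) * (res L (Defs.shift v x) == q)%:R.
  by apply/funext => x; rewrite {1}(cylf_expand Lf).
have cs q := cylf_shift v (cq q).
rewrite (state_sum Em_state) => [|q]; last first.
  exact: (cylf_comp (fun b => f (extL q) * b) (cs q)).
apply: eq_bigr => q _; rewrite (stateZ Em_state) //; congr (_ * _).
rewrite (prob_Em _ (@cylf_res d A L)) -(inv v); last first.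
  apply: cyle_measurable; exact: (cyle_fiber [set q] (@cylf_res d A L)).
by rewrite -(prob_Em q (cylf_shift v (@cylf_res d A L))).
Qed.

Lemma Hbox_Hs n : Hbox mu n = Hs Em (box d n).
Proof.
pose f (x : config) := [ffun k => x (@boxpt d n k)].
have cf : cylf f.
  exists (box d n) => x y xy; apply/ffunP => k; rewrite !ffunE; apply: xy.
  by apply/imfsetP; exists k.
have E : Hbox mu n = ent Em f.
  apply: eq_bigr => p _; rewrite (prob_Em p cf).
  rewrite (_ : @boxcyl d n A p = [set x | f x = p]) //.
  apply/seteqP; split=> x /=; first by move=> H; apply/ffunP => k; rewrite ffunE.
  by move=> <- k; rewrite ffunE.
rewrite E; apply/eqP; rewrite eq_le; apply/andP.
split; apply: (ent_le_determined Em_state) => //; do ?[exact: cylf_res].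
  move=> x y /res_eqP H; apply/ffunP => k; rewrite !ffunE; apply: H.
  by apply/imfsetP; exists k.
move=> x y H; apply/res_eqP => i /imfsetP[k _ ->].
by move/ffunP: H => /(_ k); rewrite !ffunE.
Qed.

End OneProbability.

Lemma state_probability (m : (config -> R) -> R) : state m ->
  exists P : probability (X d a0) R,
    (forall f, cylf f -> Em P f = m f) /\ (invariant m -> shift_invariant P).
Proof.
move=> ms; have [P PE] := state_extension a0 ms.
have PI (B : set config) : cyle B -> Em P \1_B = m \1_B.
  by move=> cB; rewrite Em_indic // PE.
have PF f : cylf f -> Em P f = m f.
  move=> [L Lf]; rewrite (state_expand (Em_state P) Lf) (state_expand ms Lf).
  apply: eq_bigr => q _; congr (_ * _).
  have cq : cyle [set x | res L x = q] := cyle_fiber [set q] (@cylf_res d A L).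
  rewrite /prob (_ : (fun x => _) = \1_[set x | res L x = q]) ?PI //.
  apply/funext => x; rewrite indicE; congr (_%:R).
  by congr nat_of_bool; apply/eqP/idP => [?|/set_mem]; rewrite ?inE.
exists P; split=> // inv v B mB.
have mshift : measurable_fun setT (Defs.shift v : X d a0 -> X d a0).
  apply: (@measurability _ _ (X d a0) (X d a0) setT _ (@cylinders d (ptA a0)) erefl).
  move=> _ [_ [L [w ->]] <-].
  rewrite setTI; apply: cyle_measurable.
  apply: (cylf_shift v); exists L => x y xy; apply/propext; split=> H i iL.
    by rewrite -(xy i iL) H.
  by rewrite (xy i iL) H.
(* Cylinder events form a generating pi-system on which [P] and its image under the shift agree,
   because [m] is invariant. *)
have := @measure_unique _ R (X d a0) (@cyle d A) (fun=> setT) _ _ _ _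
  (pushforward P (Defs.shift v : X d a0 -> X d a0)) P.
apply => //.
- apply/seteqP; split.
    apply: smallest_sub; first exact: smallest_sigma_algebra.
    move=> C [L [w ->]]; apply: sub_sigma_algebra.
    exists L => x y xy; apply/propext; split=> H i iL.
      by rewrite -(xy i iL) H.
    by rewrite (xy i iL) H.
  apply: smallest_sub; first exact: sigma_algebra_measurable.
  by move=> C; exact: cyle_measurable.
- exact: cyleI.
- by move=> _; exact: cylf_cst.
- by rewrite bigcup_const.
- move=> C cC; apply: (etrans (PE _ (cylf_shift v cC))); apply/esym.
  apply: (etrans (PE _ cC)); congr (_%:E).
  by rewrite -(inv v) //; exact: cylf_indic.
- by move=> _; apply: (le_lt_trans (y := P setT)) => //; rewrite probability_setT ltry.
Qed.

End ProbabilityState.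

(** * Entropy density and ultralimits of averages *)

Section RealSequences.
Variable R : realType.

(** The second hypothesis bounds the upper limit by every [a k], hence by the infimum. It plays the
    part of subadditivity in Fekete's lemma. *)
Lemma cvg_inf_almost_monotone (a : nat -> R) :
  (forall k, 0 <= a k) ->
  (forall k e, 0 < e -> \forall N \near \oo, a N <= a k + e) ->
  a @ \oo --> inf (range a).
Proof.
move=> a0 aN; have hi : has_inf (range a).
  by split; [exists (a 0%N), 0%N|exists 0 => _ [k _ <-]].
apply/cvgrPdist_le => e e0.
have [|_ [k _ <-] ak] := @inf_adherent _ (range a) (e / 2) _ hi; first by lra.
near=> N.
have le1 : inf (range a) <= a N by apply: ge_inf; [exact: hi.2|exists N].
have le2 : a N <= a k + e / 2 by near: N; apply: aN; lra.
by rewrite ler_norml; apply/andP; split; lra.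
Unshelve. all: by end_near. Qed.

(** Upper semicontinuity suffices, since entropy must only not drop in a limit. Every tangent of
    [eta] is an affine majorant and passes to the limit; for [l = 0] the tangent at [e / 2] takes
    the value [e / 2] there. *)
Lemma eta_usc (U : set_system nat) {FU : Filter U} (x : nat -> R) (l e : R) :
  (forall n, 0 <= x n) -> 0 <= l -> x @ U --> l -> 0 < e ->
  \forall n \near U, eta (x n) <= eta l + e.
Proof.
move=> x0 l0 xl e0.
have key b : 0 < b -> b - l - l * ln b < eta l + e ->
    \forall n \near U, eta (x n) <= eta l + e.
  move=> b0 hb.
  have : (fun n => b - x n - x n * ln b) @ U --> b - l - l * ln b.
    apply: cvgB; last exact: cvgMr_tmp.
    by apply: cvgB => //; exact: cvg_cst.
  move=> /cvgr_lt /(_ _ hb); apply: filterS => n h.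
  exact: le_trans (eta_le_tangent (x0 n) b0) (ltW h).
have [l0'|ln0] := eqVneq l 0.
  by apply: (key (e / 2)); rewrite ?l0' ?eta0; lra.
by apply: (key l); rewrite ?etaE ?lt_neqAle ?(eq_sym 0) ?ln0 //; lra.
Qed.

Lemma ultra_bounded_cvg (U : set_system nat) (u : nat -> R) (M : R) :
  UltraFilter U -> (forall n, `|u n| <= M) -> u @ U --> lim (u @ U).
Proof.
move=> UU uM.
have uU : UltraFilter (u @ U).
  have PU := @ultra_proper _ _ UU.
  apply: (@Build_UltraFilter R (u @ U) _) => G PG uG.
  apply/seteqP; split=> // B GB.
  have [//|h] := in_ultra_setVsetC (u @^-1` B) UU.
  have : G (~` B) by apply: uG; exact: h.
  move=> GnB; have : G (B `&` ~` B) by exact: filterI.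
  by rewrite setICr => /filter_not_empty.
have := @segment_compact R (- M) M; rewrite compact_ultra => /(_ _ uU).
have hM : (u @ U) `[- M, M]%classic.
  have PU := @ultra_proper _ _ UU.
  by apply: (@filterE _ U) => n; rewrite /= in_itv /= -ler_norml; exact: uM.
by move=> /(_ hM) [l [_ ul]]; apply/cvg_ex; exists l.
Qed.

End RealSequences.

Section FsetSums.
Variables (T : choiceType) (R : realType).

Lemma fset_sum_sub (S B : {fset T}) (g : T -> R) (M : R) : (S `<=` B)%fset ->
  (forall v, v \in B -> `|g v| <= M) ->
  `|\sum_(v <- B) g v - \sum_(v <- S) g v| <= (#|` B|%:R - #|` S|%:R) * M.
Proof.
move=> SB gM.
have -> : \sum_(v <- B) g v = \sum_(v <- S) g v + \sum_(v <- (B `\` S)%fset) g v.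
  rewrite (big_fsetID _ (mem S)) /=; congr (_ + _); apply: eq_fbigl => v.
    by rewrite !inE /=; case: (boolP (v \in S)); rewrite ?andbF ?andbT // => /(fsubsetP SB).
  by rewrite !inE /= andbC.
rewrite addrC addKr -natrB ?fsubset_leq_card // -cardfsDS //.
apply: le_trans (ler_norm_sum _ _ _) _.
rewrite big_seq; apply: (@le_trans _ _ (\sum_(v <- (B `\` S)%fset | v \in (B `\` S)%fset) M)).
  by apply: ler_sum => v; rewrite inE => /andP[_ /gM].
by rewrite -big_seq big_const_seq count_predT iter_addr_0 mulr_natl.
Qed.

End FsetSums.

Lemma sum_trans (d : nat) (R : realType) (w : Zd d) (L : {fset Zd d}) (g : Zd d -> R) :
  \sum_(v <- trans w L) g v = \sum_(v <- L) g (v + w).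
Proof. by rewrite big_imfset //= => u v _ _ /addIr. Qed.

Section EntropyLimit.
Variables (d : nat) (A : finType) (a0 : A) (R : realType).
Local Notation config := (Zd d -> A).
Local Notation box := (box d).

Lemma card_box_gt0 n : 0 < #|` box n|%:R :> R.
Proof. by rewrite ltr0n box_gt0. Qed.

Lemma boundary_small k (C e : R) : 0 < e ->
  \forall N \near \oo, (#|` box (N + k)|%:R - #|` box N|%:R) * C <= e * #|` box N|%:R.
Proof.
move=> e0; have := @card_box_ratio d R k.
have eC : 0 < e / (`|C| + 1) by rewrite divr_gt0 // ltr_wpDl.
move=> /cvgrPdist_le /(_ _ eC); apply: filterS => N.
rewrite distrC => h; have {}h := le_trans (ler_norm _) h.
have b0 := card_box_gt0 N.
have bb : 0 <= #|` box (N + k)|%:R - #|` box N|%:R :> R.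
  by rewrite subr_ge0 ler_nat fsubset_leq_card // box_sub // leq_addr.
have h1 : #|` box (N + k)|%:R - #|` box N|%:R <= e / (`|C| + 1) * #|` box N|%:R.
  rewrite -(ler_pM2r b0) mulrBl divfK ?gt_eqF // mul1r in h; exact: h.
apply: (@le_trans _ _ (e / (`|C| + 1) * #|` box N|%:R * (`|C| + 1))).
  apply: (le_trans (y := (#|` box (N + k)|%:R - #|` box N|%:R) * (`|C| + 1))).
    by rewrite ler_wpM2l // (le_trans (ler_norm _)) // lerDl.
  by rewrite ler_wpM2r // addr_ge0.
by rewrite mulrAC divfK // gt_eqF // ltr_wpDl.
Qed.

(** Shearer's inequality makes the entropy per site of [box N] eventually at most that of [box k]
    plus [e]. Thus the limit that defines [entropy] exists, and every single box bounds it from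
    above. *)
Lemma invariant_entropy_cvg (m : (config -> R) -> R) : state m -> invariant m ->
  (fun n => Hs m (box n) / #|` box n|%:R) @ \oo -->
  inf (range (fun n => Hs m (box n) / #|` box n|%:R)).
Proof.
move=> ms inv; apply: cvg_inf_almost_monotone => [k|k e e0].
  by rewrite divr_ge0 // Hs_ge0.
have := boundary_small k (ln #|A|%:R) e0; apply: filterS => N hN.
have bN := card_box_gt0 N; have bk := card_box_gt0 k.
have := entropy_box_cover ms k N.
under eq_bigr do rewrite (Hs_trans ms _ _ inv).
rewrite big_const_seq count_predT iter_addr_0 -[Hs _ _ *+ _]mulr_natr => h.
rewrite ler_pdivrMr //.
have : #|` box k|%:R * Hs m (box N) <=
    #|` box k|%:R * ((Hs m (box k) / #|` box k|%:R + e) * #|` box N|%:R).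
  have -> : #|` box k|%:R * ((Hs m (box k) / #|` box k|%:R + e) * #|` box N|%:R)
      = (Hs m (box k) / #|` box k|%:R * #|` box k|%:R) * #|` box N|%:R
        + #|` box k|%:R * (e * #|` box N|%:R) by lra.
  rewrite divfK ?gt_eqF //; apply: (le_trans h); rewrite lerD2l mulrCA.
  by rewrite ler_pM2l.
by rewrite ler_pM2l.
Qed.

Lemma entropyE (mu : probability (X d a0) R) :
  entropy mu = limn (fun n => Hs (Em mu) (box n) / #|` box n|%:R).
Proof.
rewrite /entropy; congr (limn _); apply/funext => n.
by rewrite Hbox_Hs card_box.
Qed.

Lemma entropy_le_box (mu : probability (X d a0) R) k : shift_invariant mu ->
  entropy mu <= Hs (Em mu) (box k) / #|` box k|%:R.
Proof.
move=> /invariant_Em inv; have ms := Em_state mu.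
rewrite entropyE (cvg_lim _ (invariant_entropy_cvg ms inv)) //.
apply: ge_inf; last by exists k.
by exists 0 => _ [n _ <-]; rewrite divr_ge0 // Hs_ge0.
Qed.

Lemma le_entropy (mu : probability (X d a0) R) c : shift_invariant mu ->
  (forall k, c <= Hs (Em mu) (box k) / #|` box k|%:R) -> c <= entropy mu.
Proof.
move=> /invariant_Em inv H; have ms := Em_state mu.
rewrite entropyE (cvg_lim _ (invariant_entropy_cvg ms inv)) //.
apply: lb_le_inf; first by exists (Hs (Em mu) (box 0) / #|` box 0|%:R), 0%N.
by move=> _ [n _ <-].
Qed.

End EntropyLimit.

(** * Invariant limits of finite-volume states *)

Section UltraAverage.
Variables (d : nat) (A : finType) (a0 : A) (R : realType).
Local Notation config := (Zd d -> A).
Local Notation box := (box d).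
Variables (mm : nat -> (config -> R) -> R) (mms : forall n, state (mm n)).

(** Finite-volume states are not invariant; averaging over translates makes them so up to a boundary
    term. *)
Definition avg n (f : config -> R) : R :=
  (\sum_(v <- box n) mm n (fun x => f (Defs.shift v x))) / #|` box n|%:R.

Lemma avg_state n : state (avg n).
Proof.
have bN := card_box_gt0 d R n.
split=> [|f cf f0|c f g cf cg].
- rewrite /avg; under eq_bigr do rewrite (state1 (mms n)).
  by rewrite big_const_seq count_predT iter_addr_0 divff // gt_eqF.
- apply: divr_ge0 => //; apply: sumr_ge0 => v _; apply: (state_ge0 (mms n)) => //.
  exact: cylf_shift.
rewrite /avg mulrA -mulrDl; congr (_ / _); rewrite mulr_sumr -big_split /=.
by apply: eq_bigr => v _; rewrite -(state_linear (mms n)) //; exact: cylf_shift.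
Qed.

Lemma state_norm_le (m : (config -> R) -> R) f M : state m -> cylf f ->
  (forall x, `|f x| <= M) -> `|m f| <= M.
Proof.
move=> ms cf fM; rewrite ler_norml -{1}(state_cst ms (- M)) -{2}(state_cst ms M).
by apply/andP; split; apply: (state_le ms) => //; do ?[exact: cylf_cst];
  move=> x; have := fM x; rewrite ler_norml => /andP[].
Qed.

Lemma avg_shift n k w f M : w \in box k -> cylf f -> (forall x, `|f x| <= M) ->
  `|avg n (fun x => f (Defs.shift w x)) - avg n f| <=
  2 * M * ((#|` box (n + k)|%:R - #|` box n|%:R) / #|` box n|%:R).
Proof.
move=> wk cf fM; have bN := card_box_gt0 d R n.
pose g v := mm n (fun x => f (Defs.shift v x)).
have gM v : `|g v| <= M.
  by apply: (state_norm_le (mms n)) => //; exact: cylf_shift.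
have -> : avg n (fun x => f (Defs.shift w x)) =
    (\sum_(v <- trans w (box n)) g v) / #|` box n|%:R.
  rewrite /avg sum_trans.
  congr (_ / _); apply: eq_bigr => v _; congr (mm n _); apply/funext => x.
  congr f; apply/funext => i; rewrite /Defs.shift; congr x.
  by rewrite addrAC addrA.
rewrite /avg -mulrBl normrM [X in _ * X]ger0_norm ?invr_ge0 //.
rewrite mulrA ler_wpM2r ?invr_ge0 //.
have s1 : (box n `<=` box (n + k))%fset by apply: box_sub; exact: leq_addr.
have s2 : (trans w (box n) `<=` box (n + k))%fset.
  apply/fsubsetP => v; rewrite in_trans => vn.
  by rewrite -(subrK w v); apply: in_boxD.
have h1 := fset_sum_sub s1 (fun v _ => gM v).
have h2 := fset_sum_sub s2 (fun v _ => gM v).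
rewrite card_trans in h2.
set S := \sum_(v <- box (n + k)) _ in h1 h2.
rewrite (_ : _ - _ = (S - \sum_(v <- box n) g v) - (S - \sum_(v <- trans w (box n)) g v));
  last by rewrite /g; lra.
by apply: le_trans (ler_normB _ _) _; lra.
Qed.

(** Concavity of [eta]: the probability of a pattern under [avg n] is the mean of its probabilities
    on the translated boxes. *)
Lemma Hs_avg_ge n k :
  (\sum_(v <- box n) Hs (mm n) (trans v (box k))) / #|` box n|%:R <= Hs (avg n) (box k).
Proof.
have bN := card_box_gt0 d R n.
have cr := @cylf_res d A (box k).
have Hv v : Hs (mm n) (trans v (box k)) <=
    ent (mm n) (fun x => res (box k) (Defs.shift v x)).
  apply: (ent_le_determined (mms n)); [exact: cylf_res|exact: cylf_shift|].
  move=> x y /res_eqP H; apply/res_eqP => i; rewrite in_trans => iL.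
  by have := H _ iL; rewrite /Defs.shift subrK.
apply: (@le_trans _ _ ((\sum_(v <- box n)
    ent (mm n) (fun x => res (box k) (Defs.shift v x))) / #|` box n|%:R)).
  by rewrite ler_wpM2r ?invr_ge0 //; exact: ler_sum.
rewrite /Hs /ent exchange_big mulr_suml; apply: ler_sum => q _ /=.
pose x (v : box n) := prob (mm n) (fun x => res (box k) (Defs.shift (val v) x)) q.
have := @eta_concave R (box n) (fun=> #|` box n|%:R^-1) x.
have -> : \sum_(i : box n) #|` box n|%:R^-1 * eta (x i) =
   (\sum_(v <- box n) eta (prob (mm n) (fun x => res (box k) (Defs.shift v x)) q))
     / #|` box n|%:R.
  by rewrite big_seq_fsetE mulr_suml; apply: eq_bigr => v _; rewrite mulrC.
have -> : \sum_(i : box n) #|` box n|%:R^-1 * x i = prob (avg n) (res (box k)) q.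
  rewrite /prob /avg big_seq_fsetE mulr_suml; apply: eq_bigr => v _.
  by rewrite mulrC.
apply.
- by move=> _; rewrite invr_ge0.
- by rewrite sumr_const cardfE -[_ *+ _]mulr_natl divff // -cardfE gt_eqF.
- by move=> v; apply: (prob_ge0 (mms n)); exact: cylf_shift.
Qed.

Variables (U : set_system nat) (UU : UltraFilter U) (oU : \oo `<=` U).

(** An ultrafilter gives the limits for all cylinder functions at once, with no extraction of
    subsequences. *)
Definition ulim (f : config -> R) : R := lim (avg n f @[n --> U]).

Lemma avg_cvg f : cylf f -> avg n f @[n --> U] --> ulim f.
Proof.
move=> cf; have [M fM] := cylf_bounded a0 cf.
apply: (ultra_bounded_cvg (M := M) UU) => n.
exact: (state_norm_le (avg_state n)).
Qed.

Let PU := @ultra_proper _ _ UU.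

Lemma ulim_state : state ulim.
Proof.
have PU' : ProperFilter U := PU; split=> [|f cf f0|c f g cf cg].
- apply/cvg_lim => //.
  rewrite (_ : (fun n => _) = fun=> 1); first exact: cvg_cst.
  by apply/funext => n; exact: state1 (avg_state n).
- apply: limr_ge; first by apply/cvg_ex; exists (ulim f); exact: avg_cvg.
  by apply: nearW => n; exact: (state_ge0 (avg_state n)).
apply/cvg_lim => //.
rewrite (_ : (fun n => _) = fun n => c * avg n f + avg n g).
  apply: cvgD; last exact: avg_cvg.
  by apply: cvgMl_tmp; exact: avg_cvg.
by apply/funext => n; exact: (state_linear (avg_state n)).
Qed.

Lemma ulim_invariant : invariant ulim.
Proof.
have PU' : ProperFilter U := PU; move=> w f cf; have [M fM] := cylf_bounded a0 cf.
have [k wk] : exists k, w \in box k.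
  by have [k /fsubsetP H] := sub_box_ex [fset w]%fset; exists k; apply: H; rewrite inE.
have cfw := cylf_shift w cf.
apply/eqP; rewrite -subr_eq0 -normr_le0; apply/ler_addgt0Pr => e e0; rewrite add0r.
have : (fun n => `|avg n (fun x => f (Defs.shift w x)) - avg n f|) @ U -->
   `|ulim (fun x => f (Defs.shift w x)) - ulim f|.
  by apply: cvg_norm; apply: cvgB; exact: avg_cvg.
move=> H; rewrite -(cvg_lim _ H) //; apply: limr_le; first by apply/cvg_ex; eexists; exact: H.
have := oU (boundary_small d k (2 * M) e0); apply: filterS => n h.
apply: le_trans (avg_shift n wk cf fM) _.
by rewrite mulrA ler_pdivrMr ?card_box_gt0 // mulrC.
Qed.

(** The entropy of [mm n] on [box n] is controlled by its mean over translates of [box k] (Shearer),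
    this by the entropy of [avg n] on [box k] (concavity), and this by that of the limit (upper
    semicontinuity). The boundary and the passage to the limit get [e / 2] each. *)
Lemma Hs_ulim_ge c k : (\forall n \near U, c <= Hs (mm n) (box n) / #|` box n|%:R) ->
  c <= Hs ulim (box k) / #|` box k|%:R.
Proof.
have PU' : ProperFilter U := PU; move=> Hc; have bk := card_box_gt0 d R k.
apply/ler_addgt0Pr => e e0.
have e2 : 0 < e / 2 by lra.
have Q0 : 0 < #|{ffun box k -> A}|%:R :> R.
  by rewrite ltr0n card_ffun expn_gt0; apply/orP; left; apply/card_gt0P; exists a0.
have h1 : \forall n \near U, Hs (avg n) (box k) <= Hs ulim (box k) + e / 2.
  have : \forall n \near U, forall q, eta (prob (avg n) (res (box k)) q) <=
     eta (prob ulim (res (box k)) q) + e / 2 / #|{ffun box k -> A}|%:R.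
    apply: filter_forall => q; apply: eta_usc.
    - by move=> n; apply: (prob_ge0 (avg_state n)); exact: cylf_res.
    - by apply: (prob_ge0 ulim_state); exact: cylf_res.
    - by apply: avg_cvg; exact/cylf_eq/cylf_res.
    - by rewrite divr_gt0.
  apply: filterS => n H; apply: le_trans (ler_sum _ (fun q _ => H q)) _.
  rewrite big_split /= lerD2l sumr_const -[_ *+ _]mulr_natr divfK //.
  by rewrite gt_eqF.
have h2 := oU (boundary_small d k (ln #|A|%:R) e2).
have [n [H1 H2 H3]] : exists n,
    [/\ Hs (avg n) (box k) <= Hs ulim (box k) + e / 2,
      (#|` box (n + k)|%:R - #|` box n|%:R) * ln #|A|%:R <= e / 2 * #|` box n|%:R &
      c <= Hs (mm n) (box n) / #|` box n|%:R].
  by apply: (@filter_ex _ U); near=> n; split; near: n.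
have bn := card_box_gt0 d R n.
have H4 := entropy_box_cover (mms n) k n.
have H5 := Hs_avg_ge n k.
rewrite ler_pdivlMr // in H3; rewrite ler_pdivrMr // in H5.
have k1 : 1 <= #|` box k|%:R :> R by rewrite ler1n box_gt0.
have H6 : #|` box k|%:R * (c * #|` box n|%:R) <= #|` box k|%:R * Hs (mm n) (box n).
  by rewrite ler_pM2l.
have H7 : #|` box k|%:R * ((#|` box (n + k)|%:R - #|` box n|%:R) * ln #|A|%:R)
   <= #|` box k|%:R * (e / 2 * #|` box n|%:R) by rewrite ler_pM2l.
have H8 : (c * #|` box k|%:R) * #|` box n|%:R <=
    (Hs (avg n) (box k) + e / 2 * #|` box k|%:R) * #|` box n|%:R by lra.
rewrite ler_pM2r // in H8.
have H9 : e / 2 <= e / 2 * #|` box k|%:R by rewrite ler_peMr // ltW.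
have H10 : c * #|` box k|%:R <= (Hs ulim (box k) / #|` box k|%:R + e) * #|` box k|%:R.
  by rewrite mulrDl divfK ?gt_eqF //; lra.
by rewrite ler_pM2r in H10.
Unshelve. all: by end_near. Qed.

End UltraAverage.

(** * Absolutely summable interactions *)

Section SummableFamilies.
Variables (R : realType) (T : choiceType) (S : set T).
Implicit Types (a b : T -> R) (F G : {fset T}).

Definition fsub G (P : set T) := forall i, i \in G -> P i.

Lemma esum_fset_ge a G : (forall i, 0 <= a i) -> fsub G S ->
  ((\sum_(i <- G) a i)%:E <= \esum_(i in S) (a i)%:E)%E.
Proof.
move=> a0 GS; apply: esum_ge; exists [set` G].
  by split; [exact: finite_fset|exact: GS].
by rewrite fsbig_finite ?finite_fset //= set_fsetK sumEFin.
Qed.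

Lemma esum_fset_le a (c : R) : (forall i, 0 <= a i) ->
  (forall G, fsub G S -> \sum_(i <- G) a i <= c) ->
  (\esum_(i in S) (a i)%:E <= c%:E)%E.
Proof.
move=> a0 H; apply: ge_ereal_sup => _ [X [fX XS] <-].
rewrite fsbig_finite //= sumEFin lee_fin; apply: H => i.
by rewrite in_fset_set // => /set_mem; exact: XS.
Qed.

Definition tail_le a F (e : R) :=
  forall G, fsub G S -> [disjoint G & F]%fset -> \sum_(i <- G) a i <= e.

Lemma fset_sum_le_tail a F e G : (forall i, 0 <= a i) -> tail_le a F e ->
  fsub G S -> \sum_(i <- G) a i <= \sum_(i <- F) a i + e.
Proof.
move=> a0 tF GS; rewrite (big_fsetID _ (mem F)) /=; apply: lerD.
  apply: (@le_trans _ _ (\sum_(i <- (G `&` F)%fset) a i)).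
    by rewrite le_eqVlt; apply/orP; left; apply/eqP/eq_fbigl => i; rewrite !inE.
  rewrite [leRHS](big_fsetID _ (mem G)) /=.
  rewrite [X in X + _](_ : _ = \sum_(i <- (G `&` F)%fset) a i); last first.
    by apply: eq_fbigl => i; rewrite !inE andbC.
  by rewrite lerDl sumr_ge0.
apply: tF => [i|]; first by rewrite !inE => /andP[/GS].
by apply/fdisjointP => i; rewrite !inE => /andP[].
Qed.

Lemma tail_exists a e : (forall i, 0 <= a i) ->
  (\esum_(i in S) (a i)%:E < +oo)%E -> 0 < e ->
  exists2 F, fsub F S & tail_le a F e.
Proof.
move=> a0 afin e0.
have fin : (\esum_(i in S) (a i)%:E)%E \is a fin_num.
  by rewrite ge0_fin_numE // esum_ge0 // => i _; rewrite lee_fin.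
have [_ [X [fX XS] <-]] := ub_ereal_sup_adherent e0 fin.
rewrite -/(esum _ _) fsbig_finite //= sumEFin => Xe.
exists (fset_set X) => [i|G GS dG].
  by rewrite in_fset_set // => /set_mem; exact: XS.
have GXS : fsub (G `|` fset_set X)%fset S.
  move=> i; rewrite inE => /orP[/GS //|].
  by rewrite in_fset_set // => /set_mem; exact: XS.
have := esum_fset_ge a0 GXS.
rewrite -(fineK fin) in Xe *.
rewrite lee_fin (big_fsetID _ (mem G)) /=.
rewrite [X in X + _](_ : _ = \sum_(i <- G) a i); last first.
  by apply: eq_fbigl => i; rewrite !inE /=; case: (i \in G); rewrite ?andbF ?orbF.
rewrite [X in _ + X](_ : _ = \sum_(i <- fset_set X) a i); last first.
  apply: eq_fbigl => i; rewrite !inE /=.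
  have [iG|iG] := boolP (i \in G); rewrite ?andbF ?andbT //=.
  by have /fdisjointP/(_ i iG)/negPf -> := dG.
rewrite -EFinB lte_fin in Xe; move: Xe.
by move: (fine _) => E; lra.
Qed.

Lemma esum_tail a b F e : (forall i, 0 <= a i) -> (forall i, 0 <= b i <= a i) ->
  fsub F S -> tail_le a F e ->
  \sum_(i <- F) b i <= fine (\esum_(i in S) (b i)%:E) <= \sum_(i <- F) b i + e.
Proof.
move=> a0 ba FS tF; have b0 i : 0 <= b i by have /andP[] := ba i.
have h1 := esum_fset_ge b0 FS.
have h2 : (\esum_(i in S) (b i)%:E <= (\sum_(i <- F) b i + e)%:E)%E.
  apply: esum_fset_le => // G; apply: fset_sum_le_tail => // G' G'S dG'.
  apply: le_trans (tF G' G'S dG').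
  by apply: ler_sum => i _; have /andP[] := ba i.
have fin : (\esum_(i in S) (b i)%:E)%E \is a fin_num.
  rewrite ge0_fin_numE; first exact: le_lt_trans h2 (ltry _).
  by apply: esum_ge0 => i _; rewrite lee_fin.
by rewrite -(fineK fin) !lee_fin in h1 h2; apply/andP.
Qed.

End SummableFamilies.

Section Interaction.
Variables (d : nat) (A : finType) (a0 : A) (R : realType).
Local Notation config := (Zd d -> A).
Local Notation box := (box d).
Variable Phi : {fset Zd d} -> config -> R.
Hypotheses (Ploc : local_interaction Phi) (Pinv : shift_invariant_interaction Phi)
  (Psum : (\esum_(L in @contains0 d) (supnorm Phi L)%:E < +oo)%E).

Local Notation nrm := (supnorm Phi).

Lemma Phi_cylf L : cylf (Phi L).
Proof. by exists L => x y; exact: Ploc. Qed.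

Lemma Phi_le L x : `|Phi L x| <= nrm L.
Proof.
apply: ub_le_sup; last by exists x.
have [M PM] := cylf_bounded a0 (Phi_cylf L).
by exists M => _ [y _ <-].
Qed.

Lemma nrm_ge0 L : 0 <= nrm L.
Proof. exact: le_trans (normr_ge0 _) (Phi_le L (fun=> a0)). Qed.

Lemma Phi_trans v L x : Phi (trans v L) x = Phi L (Defs.shift v x).
Proof. exact: Pinv. Qed.

Lemma shiftK v : cancel (@Defs.shift d A v) (Defs.shift (- v)).
Proof. by move=> x; apply/funext => i; rewrite /Defs.shift addrNK. Qed.

Lemma nrm_trans v L : nrm (trans v L) = nrm L.
Proof.
rewrite /supnorm; congr sup; apply/seteqP; split=> [_ [x _ <-]|_ [x _ <-]].
  by exists (Defs.shift v x) => //; rewrite Phi_trans.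
exists (Defs.shift (- v) x) => //; rewrite Phi_trans.
by have := shiftK (- v) x; rewrite opprK => ->.
Qed.

Lemma trans_inj v : injective (@trans d v).
Proof.
move=> L L' LL; apply/fsetP => i.
by have := congr1 (fun K : {fset Zd d} => i + v \in K) LL; rewrite !in_trans addrK.
Qed.

Lemma transK (v : Zd d) (L : {fset Zd d}) : trans v (trans (- v) L) = L.
Proof. by apply/fsetP => i; rewrite !in_trans opprK subrK. Qed.

Lemma sum_nrm_trans v (G : {fset {fset Zd d}}) :
  \sum_(L <- G) nrm L = \sum_(L <- [fset trans v L | L in G]%fset) nrm L.
Proof.
rewrite big_imfset /=; last by move=> L L' _ _; exact: trans_inj.
by apply: eq_bigr => L _; rewrite nrm_trans.
Qed.

Definition Pnorm : R := fine (\esum_(L in @contains0 d) (nrm L)%:E).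

Lemma sum_nrm_site u (G : {fset {fset Zd d}}) : (forall L, L \in G -> u \in L) ->
  \sum_(L <- G) nrm L <= Pnorm.
Proof.
move=> Gu; rewrite (sum_nrm_trans (- u)).
have fin : (\esum_(L in @contains0 d) (nrm L)%:E)%E \is a fin_num.
  by rewrite ge0_fin_numE // esum_ge0 // => L _; rewrite lee_fin nrm_ge0.
rewrite -lee_fin /Pnorm fineK //; apply: esum_fset_ge; first exact: nrm_ge0.
move=> _ /imfsetP[L /= LG ->]; rewrite /contains0 /= in_trans opprK add0r.
exact: Gu.
Qed.

Lemma sum_nrm_tail u F e (G : {fset {fset Zd d}}) :
  tail_le (@contains0 d) nrm F e ->
  (forall L, L \in G -> u \in L /\ trans (- u) L \notin F) ->
  \sum_(L <- G) nrm L <= e.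
Proof.
move=> tF Gu; rewrite (sum_nrm_trans (- u)); apply: tF.
  move=> _ /imfsetP[L /= LG ->]; rewrite /contains0 /= in_trans opprK add0r.
  exact: (Gu L LG).1.
by apply/fdisjointP => _ /imfsetP[L /= LG ->]; exact: (Gu L LG).2.
Qed.

Lemma radius (F : {fset {fset Zd d}}) : exists r, forall L, L \in F -> (L `<=` box r)%fset.
Proof.
have [r H] := sub_box_ex (\bigcup_(L <- F) L)%fset.
exists r => L LF; apply: fsubset_trans H.
exact: (@bigfcup_sup _ _ _ L xpredT id).
Qed.

Lemma trans_sub (v : Zd d) (L L' : {fset Zd d}) : (trans v L `<=` trans v L')%fset = (L `<=` L')%fset.
Proof.
apply/fsubsetP/fsubsetP => H i.
  by move=> iL; have := H (i + v); rewrite !in_trans !addrK; apply.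
by rewrite !in_trans; exact: H.
Qed.

(** Take [F] with tail at most [e], and [r] such that [box r] contains all members of [F]. A set
    that leaves [trans u (box r)] is a translate by [u] of a set outside [F]. *)
Lemma nrm_tail e : 0 < e -> exists r, forall u (G : {fset {fset Zd d}}),
  (forall L, L \in G -> u \in L /\ ~~ (L `<=` trans u (box r))%fset) ->
  \sum_(L <- G) nrm L <= e.
Proof.
move=> e0; have [F _ tF] := tail_exists nrm_ge0 Psum e0.
have [r rF] := radius F; exists r => u G Gu.
apply: (sum_nrm_tail tF (u := u)) => L /Gu[uL nL]; split=> //.
apply: contra nL => /rF H.
by rewrite -(transK u L) trans_sub.
Qed.

Definition phiF (F : {fset {fset Zd d}}) (x : config) : R :=
  \sum_(L <- F) Phi L x / #|` L|%:R.

Lemma phiF_cylf F : cylf (phiF F).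
Proof. by apply: cylf_sum => L; exact: (cylf_comp (fun y => y / _) (Phi_cylf L)). Qed.

Lemma potential_approx F e x : fsub F (@contains0 d) ->
  tail_le (@contains0 d) nrm F e ->
  `|potential Phi x - phiF F x| <= e.
Proof.
move=> FS tF; set y := fun L => Phi L x / #|` L|%:R.
have yn L : `|y L| <= nrm L.
  rewrite /y normrM normfV normr_nat; apply: le_trans (Phi_le L x).
  have [->|L0] := eqVneq #|` L| 0%N; first by rewrite invr0 mulr0.
  by rewrite ler_pdivrMr ?ltr0n ?lt0n // ler_peMr // ler1n lt0n.
have p0 L : 0 <= Num.max (y L) 0 <= nrm L.
  by rewrite le_max lexx orbT ge_max nrm_ge0 andbT (le_trans (ler_norm _)).
have n0 L : 0 <= Num.max (- y L) 0 <= nrm L.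
  rewrite le_max lexx orbT ge_max nrm_ge0 andbT /=.
  by rewrite (le_trans (ler_norm _)) // normrN.
have := esum_tail nrm_ge0 p0 FS tF; have := esum_tail nrm_ge0 n0 FS tF.
rewrite /potential -/y; set N := fine _; set P := fine _.
have -> : phiF F x = \sum_(L <- F) Num.max (y L) 0 - \sum_(L <- F) Num.max (- y L) 0.
  rewrite -sumrB; apply: eq_bigr => L _; rewrite -/(y L).
  by case: (leP (y L) 0) => h; case: (leP (- y L) 0) => h'; lra.
by move=> /andP[? ?] /andP[? ?]; rewrite ler_norml; apply/andP; split; lra.
Qed.

End Interaction.

(** * Finite-volume energies *)

Section Energy.
Variables (d : nat) (A : finType) (a0 : A) (R : realType).
Local Notation config := (Zd d -> A).
Local Notation box := (box d).
Variable Phi : {fset Zd d} -> config -> R.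
Hypotheses (Ploc : local_interaction Phi) (Pinv : shift_invariant_interaction Phi)
  (Psum : (\esum_(L in @contains0 d) (supnorm Phi L)%:E < +oo)%E).
Local Notation nrm := (supnorm Phi).
Implicit Types (S W V L : {fset Zd d}) (u v : Zd d).

(** The Hamiltonian with free boundary condition, signed like the potential: Gibbs weights are
    [expR (b * energy)]. The empty set contains no site, hence is absent from the potential too. *)
Definition energy S (x : config) : R :=
  \sum_(L <- fpowerset S | L != fset0) Phi L x.

Lemma energy_cylf S : cylf (energy S).
Proof.
have [L H] := @cylf_sum d A R _ (fpowerset S)
  (fun L x => if L != fset0 then Phi L x else 0)
  (fun L => cylf_comp (fun y => if L != fset0 then y else 0) (Phi_cylf Ploc L)).
by exists L => x y xy; rewrite /energy !(big_mkcond (fun L => L != fset0)); exact: H.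
Qed.

Lemma energy_agree S x y : agree S x y -> energy S x = energy S y.
Proof.
move=> xy; rewrite /energy [LHS]big_seq_cond [RHS]big_seq_cond; apply: eq_bigr => L.
by rewrite fpowersetE => /andP[LS _]; apply: Ploc; exact: agreeS xy.
Qed.

Lemma energy_trans v S x : energy (trans v S) x = energy S (Defs.shift v x).
Proof.
rewrite /energy.
have -> : fpowerset (trans v S) = [fset trans v L | L in fpowerset S]%fset.
  apply/fsetP => L; apply/idP/imfsetP => [|[K /= KS ->]].
    rewrite fpowersetE -{1}(transK v L) trans_sub => LS.
    by exists (trans (- v) L); rewrite /= ?fpowersetE ?transK.
  by rewrite fpowersetE trans_sub -fpowersetE.
rewrite (big_mkcond (fun L => L != fset0)) big_imfset /=; last first.
  by move=> L L' _ _; exact: trans_inj.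
rewrite [RHS]big_mkcond; apply: eq_bigr => L _.
by rewrite -!cardfs_eq0 card_trans Phi_trans.
Qed.

Lemma energy_sub S W x : (W `<=` S)%fset ->
  energy S x - energy W x = \sum_(L <- fpowerset S | ~~ (L `<=` W)%fset) Phi L x.
Proof.
move=> WS; rewrite {1}/energy (bigID (fun L => (L `<=` W)%fset)) /=.
have -> : \sum_(L <- fpowerset S | (L != fset0) && (L `<=` W)%fset) Phi L x = energy W x.
  rewrite /energy [LHS]big_mkcond [RHS]big_mkcond /=.
  rewrite -(@big_fset_incl _ _ _ _ (fpowerset W)) ?fpowersetS //.
    by apply: eq_fbigr => L; rewrite fpowersetE => -> _; rewrite andbT.
  by move=> L _; rewrite fpowersetE => /negPf ->; rewrite andbF.
rewrite addrC addrK; apply: eq_bigl => L; have [->|//] := eqVneq L fset0.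
by rewrite fsub0set.
Qed.

(* Bounds the interaction of [V] with the complement of [W] inside [S]. *)
Definition crossing S W V : R :=
  \sum_(u <- V) \sum_(L <- fpowerset S | (u \in L) && ~~ (L `<=` W)%fset) nrm L.

(** Only sets that meet [V] and leave [W] survive in the difference. Such a set contributes at most
    [2 * nrm L], and [crossing] counts it at least once, at a site of its intersection with [V]. *)
Lemma energy_split S W V x y : (W `<=` S)%fset ->
  (forall i, i \notin V -> x i = y i) ->
  `|(energy S y - energy S x) - (energy W y - energy W x)| <= 2 * crossing S W V.
Proof.
move=> WS xy.
have -> : energy S y - energy S x - (energy W y - energy W x) =
  \sum_(L <- fpowerset S | ~~ (L `<=` W)%fset) (Phi L y - Phi L x).
  by rewrite sumrB -!energy_sub //; lra.
apply: le_trans (ler_norm_sum _ _ _) _; rewrite /crossing.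
under [X in _ <= _ * X]eq_bigr do rewrite big_mkcond.
rewrite exchange_big mulr_sumr [leLHS]big_mkcond /=; apply: ler_sum => L _.
have [LW|LW] := boolP (L `<=` W)%fset; first by rewrite big1 ?mulr0 // => u _; rewrite andbF.
have nL := nrm_ge0 a0 Ploc L.
under eq_bigr do rewrite andbT.
have [LV0|/fset0Pn[u]] := eqVneq (L `&` V)%fset fset0; last first.
  rewrite inE => /andP[uL uV].
  apply: (@le_trans _ _ (2 * nrm L)).
    apply: le_trans (ler_normB _ _) _; have := Phi_le a0 Ploc L x.
    by have := Phi_le a0 Ploc L y; lra.
  rewrite ler_pM2l // (big_fsetD1 u) //= uL lerDl.
  by apply: sumr_ge0 => v _; case: ifP.
rewrite (Ploc (y := x)) ?subrr ?normr0.
  by rewrite mulr_ge0 // sumr_ge0 // => v _; case: ifP.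
move=> i iL; rewrite xy //; apply/negP => iV.
have : i \in (L `&` V)%fset by rewrite inE iL.
by rewrite LV0 inE.
Qed.

Lemma sum_nrm_pred u S (P : pred {fset Zd d}) : (forall L, P L -> u \in L) ->
  \sum_(L <- fpowerset S | P L) nrm L <= Pnorm Phi.
Proof.
move=> Pu; rewrite big_fset_condE; apply: (sum_nrm_site a0 Ploc Pinv Psum (u := u)).
by move=> L; rewrite !inE => /andP[_ /Pu].
Qed.

Lemma sum_fset_le V (c : Zd d -> R) e : (forall u, u \in V -> c u <= e) ->
  \sum_(u <- V) c u <= #|` V|%:R * e.
Proof.
move=> ce; apply: (@le_trans _ _ (\sum_(u <- V) e)).
  by rewrite big_seq [leRHS]big_seq; exact: ler_sum.
by rewrite big_const_seq count_predT iter_addr_0 mulr_natl.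
Qed.

Lemma crossing_le S W V : crossing S W V <= #|` V|%:R * Pnorm Phi.
Proof.
by apply: sum_fset_le => u _; apply: (@sum_nrm_pred u) => L /andP[].
Qed.

Definition is_tail_radius (e : R) r := forall u (G : {fset {fset Zd d}}),
  (forall L, L \in G -> u \in L /\ ~~ (L `<=` trans u (box r))%fset) ->
  \sum_(L <- G) nrm L <= e.

Lemma crossing_site_tail e r S W u : is_tail_radius e r -> (trans u (box r) `<=` W)%fset ->
  \sum_(L <- fpowerset S | (u \in L) && ~~ (L `<=` W)%fset) nrm L <= e.
Proof.
move=> er rW; rewrite big_fset_condE; apply: (er u) => L.
rewrite !inE => /andP[_ /andP[-> LW]]; split=> //.
by apply: contra LW => /fsubset_trans; exact.
Qed.

Lemma crossing_tail e r S W V : is_tail_radius e r ->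
  (forall u, u \in V -> trans u (box r) `<=` W)%fset ->
  crossing S W V <= #|` V|%:R * e.
Proof.
by move=> er VW; apply: sum_fset_le => u uV; apply: (crossing_site_tail _ er); exact: VW.
Qed.

Lemma sum_fset_boundary (V B : {fset Zd d}) (c : Zd d -> R) e M : (V `<=` B)%fset ->
  (forall u, u \in V -> c u <= e) -> (forall u, u \in B -> c u <= M) -> 0 <= e ->
  \sum_(u <- B) c u <= #|` B|%:R * e + (#|` B|%:R - #|` V|%:R) * M.
Proof.
move=> VB cV cB e0.
rewrite (big_fsetID _ (mem V)) /=; apply: lerD.
  apply: (@le_trans _ _ (#|` [fset x in B | x \in V]%fset|%:R * e)).
    by apply: sum_fset_le => u; rewrite !inE => /andP[_ /cV].
  by rewrite ler_wpM2r // ler_nat fsubset_leq_card //; apply/fsubsetP => u; rewrite !inE => /andP[].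
rewrite -natrB ?fsubset_leq_card // -cardfsDS //.
apply: (@le_trans _ _ (#|` [fset x in B | x \notin V]%fset|%:R * M)).
  by apply: sum_fset_le => u; rewrite !inE => /andP[/cB].
by rewrite le_eqVlt; apply/orP; left; apply/eqP; congr (_%:R * _); congr #|` _|;
  apply/fsetP => u; rewrite !inE andbC.
Qed.

Lemma trans_box_sub m r u : u \in box m -> (trans u (box r) `<=` box (m + r))%fset.
Proof.
move=> um; apply/fsubsetP => i; rewrite in_trans => ir.
by rewrite -(subrK u i) addrC; exact: in_boxD.
Qed.

(** Sites of [box m] have their whole [r]-neighbourhood inside [box (m + r)] and cost at most [e]
    each; those of the outer shell are charged the full norm. *)
Lemma crossing_box e r S m : 0 <= e -> is_tail_radius e r ->
  crossing S (box (m + r)) (box (m + r)) <=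
  #|` box (m + r)|%:R * e + (#|` box (m + r)|%:R - #|` box m|%:R) * Pnorm Phi.
Proof.
move=> e0 er; apply: sum_fset_boundary => //.
- by apply: box_sub; exact: leq_addr.
- by move=> u um; apply: (crossing_site_tail _ er); exact: trans_box_sub.
- by move=> u _; apply: (@sum_nrm_pred u) => L /andP[].
Qed.

(** Each [Phi L] is shared equally among the sites of [L]; this is the origin of the division by
    cardinality in the potential. *)
Lemma energy_sites S x :
  energy S x = \sum_(v <- S) \sum_(L <- fpowerset S | v \in L) Phi L x / #|` L|%:R.
Proof.
under eq_bigr do rewrite big_mkcond.
rewrite exchange_big /= /energy big_mkcond /=; apply: eq_big_seq => L.
rewrite fpowersetE => LS; rewrite -big_mkcond.
have [->|L0] := eqVneq L fset0; first by rewrite big1 // => v; rewrite inE.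
have -> : \sum_(v <- S | v \in L) Phi L x / #|` L|%:R =
    \sum_(v <- L) Phi L x / #|` L|%:R.
  rewrite big_mkcond /= -(@big_fset_incl _ _ _ _ L) //.
    by apply: eq_fbigr => v -> _.
  by move=> v _ /negPf ->.
rewrite big_const_seq count_predT iter_addr_0 -[_ *+ _]mulr_natr divfK //.
by rewrite pnatr_eq0 cardfs_eq0.
Qed.

Lemma phiF_shift F v x :
  phiF Phi F (Defs.shift v x) =
  \sum_(L <- [fset trans v L | L in F]%fset) Phi L x / #|` L|%:R.
Proof.
rewrite big_imfset /=; last by move=> L L' _ _; exact: trans_inj.
by apply: eq_bigr => L _; rewrite Phi_trans // card_trans.
Qed.

Lemma fset_sum_diff (T : choiceType) (P Q : {fset T}) (g : T -> R) :
  `|\sum_(i <- P) g i - \sum_(i <- Q) g i| <=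
  \sum_(i <- (P `\` Q)%fset) `|g i| + \sum_(i <- (Q `\` P)%fset) `|g i|.
Proof.
have E (B C : {fset T}) : \sum_(i <- B) g i =
    \sum_(i <- (B `&` C)%fset) g i + \sum_(i <- (B `\` C)%fset) g i.
  rewrite (big_fsetID _ (mem C)) /=; congr (_ + _); apply: eq_fbigl => i.
    by rewrite !inE.
  by rewrite !inE andbC.
rewrite (E P Q) (E Q P) fsetIC opprD addrACA subrr add0r.
apply: le_trans (ler_normB _ _) _.
by apply: lerD; exact: ler_norm_sum.
Qed.

(** A comparison site by site. Sets at [v] outside the translate of [F] form a tail of size at most
    [e]; members of the translate that stick out of the box occur only for [v] outside [box m], and
    cost at most [Pnorm]. *)
Lemma energy_phiF e F r m x : 0 <= e -> fsub F (@contains0 d) ->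
  tail_le (@contains0 d) nrm F e ->
  (forall L, L \in F -> L `<=` box r)%fset ->
  `|energy (box (m + r)) x - \sum_(v <- box (m + r)) phiF Phi F (Defs.shift v x)| <=
  #|` box (m + r)|%:R * e +
   (#|` box (m + r)|%:R - #|` box m|%:R) * (e + Pnorm Phi).
Proof.
move=> e0 F0 tF Fr; rewrite energy_sites -sumrB.
apply: le_trans (ler_norm_sum _ _ _) _.
have wn (G : {fset {fset Zd d}}) :
    \sum_(L <- G) `|Phi L x / #|` L|%:R| <= \sum_(L <- G) nrm L.
  apply: ler_sum => L _; rewrite normrM normfV normr_nat.
  apply: le_trans (Phi_le a0 Ploc L x).
  have [->|L0] := eqVneq #|` L| 0%N; first by rewrite invr0 mulr0.
  by rewrite ler_pdivrMr ?ltr0n ?lt0n // ler_peMr // ler1n lt0n.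
have site v : `|\sum_(L <- fpowerset (box (m + r)) | v \in L) Phi L x / #|` L|%:R
    - phiF Phi F (Defs.shift v x)| <= e +
    \sum_(L <- ([fset trans v L | L in F] `\`
       [fset L in fpowerset (box (m + r)) | v \in L])%fset) nrm L.
  rewrite phiF_shift big_fset_condE; apply: le_trans (fset_sum_diff _ _ _) _.
  apply: lerD; apply: le_trans (wn _) _ => //.
  apply: (sum_nrm_tail Pinv tF (u := v)) => L; rewrite !inE.
  move=> /andP[nL /andP[_ vL]]; split=> //.
  by apply: contra nL => LF; apply/imfsetP; exists (trans (- v) L); rewrite //= transK.
apply: sum_fset_boundary => //.
- by apply: box_sub; exact: leq_addr.
- move=> v vm; apply: le_trans (site v) _.
  rewrite (_ : _ `\` _ = fset0)%fset ?big_seq_fset0 ?addr0 //.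
  apply/fsetP => L; rewrite !inE; apply/negP => /andP[nL /imfsetP[K /= KF LE]].
  move: nL; rewrite LE fpowersetE => /negP; apply; apply/andP; split.
    apply: fsubset_trans (trans_box_sub r vm).
    by rewrite trans_sub; exact: Fr.
  by rewrite in_trans subrr; exact: F0.
- move=> v _; apply: le_trans (site v) _; rewrite lerD2l.
  apply: (sum_nrm_site a0 Ploc Pinv Psum (u := v)) => L; rewrite !inE.
  move=> /andP[_ /imfsetP[K /= KF ->]].
  by rewrite in_trans subrr; exact: F0.
Qed.

End Energy.

(** * Equilibrium states and pressure *)

Section Thermodynamics.
Variables (d : nat) (A : finType) (a0 : A) (R : realType).
Local Notation config := (Zd d -> A).
Local Notation box := (box d).
Variable Phi : {fset Zd d} -> config -> R.
Hypotheses (Ploc : local_interaction Phi) (Pinv : shift_invariant_interaction Phi)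
  (Psum : (\esum_(L in @contains0 d) (supnorm Phi L)%:E < +oo)%E).
Local Notation nrm := (supnorm Phi).
Local Notation energy := (energy Phi).
Local Notation phi := (fun x : X d a0 => potential Phi (x : config)).

Lemma state_dist_le (m : (config -> R) -> R) f g c : state m -> cylf f -> cylf g ->
  (forall x, `|f x - g x| <= c) -> `|m f - m g| <= c.
Proof.
move=> ms cf cg fg.
have -> : m f - m g = m (fun x => -1 * g x + f x).
  by rewrite (state_linear ms) //; lra.
apply: (state_norm_le ms) => [|x]; last by rewrite mulN1r addrC.
exact: (cylf_comp2 (fun a b => -1 * a + b)).
Qed.

Lemma potential_measurable : measurable_fun setT phi.
Proof.
have tl k : exists F, fsub F (@contains0 d) /\
    tail_le (@contains0 d) nrm F (k.+1%:R^-1).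
  have [|F F0 tF] := @tail_exists R _ (@contains0 d) nrm k.+1%:R^-1 (nrm_ge0 a0 Ploc) Psum.
    by rewrite invr_gt0.
  by exists F.
have [F HF] := choice tl.
apply: (@measurable_fun_cvg _ _ _ setT (fun k => (phiF Phi (F k) : X d a0 -> R))).
  by move=> k; apply: cylf_measurable; exact: (phiF_cylf Ploc (F k)).
move=> x _; apply/cvgrPdist_le => e e0.
near=> k.
have [F0 tF] := HF k; apply: le_trans (potential_approx a0 Ploc x F0 tF) _.
near: k; have := @cvg_harmonic R => /cvgrPdist_le /(_ _ e0); apply: filterS => k.
by rewrite /harmonic /= sub0r normrN ger0_norm // invr_ge0.
Unshelve. all: by end_near. Qed.

Definition phimean (mu : probability (X d a0) R) : R := \int[mu]_x phi x.

Lemma free_energyE b mu : free_energy phi b mu = entropy mu + b * phimean mu.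
Proof. by []. Qed.

Lemma phimean_approx (mu : probability (X d a0) R) F e : fsub F (@contains0 d) ->
  tail_le (@contains0 d) nrm F e -> `|phimean mu - Em mu (phiF Phi F)| <= e.
Proof.
move=> F0 tF; have pa x := potential_approx a0 Ploc x F0 tF.
have iF : mu.-integrable setT (EFin \o (phiF Phi F : X d a0 -> R)).
  by apply: cylf_integrable; exact: (phiF_cylf Ploc F).
have muT : (mu setT < +oo)%E by rewrite probability_setT ltry.
have iphi : mu.-integrable setT (EFin \o phi).
  apply: measurable_bounded_integrable => //; first exact: potential_measurable.
  have [M HM] := cylf_bounded a0 (phiF_cylf Ploc F).
  exists (M + e); split; first by rewrite num_real.
  move=> K MK x _ /=; apply: le_trans (ltW MK).
  rewrite -(subrK (phiF Phi F x) (potential Phi x)) addrC.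
  by apply: le_trans (ler_normD _ _) _; apply: lerD.
have idiff : mu.-integrable setT (EFin \o (fun x : X d a0 => phi x - phiF Phi F x)).
  by have := integrableB measurableT iphi iF; exact.
rewrite /phimean /Em -RintegralB //; apply: le_trans (le_normr_Rintegral _ _) _ => //.
have -> : e = \int[mu]_(x in setT) e.
  rewrite Rintegral_cst // [X in _ * X](_ : _ = 1) ?mulr1 //.
  exact: (congr1 fine (probability_setT mu)).
apply: le_Rintegral => //.
- exact: integrable_norm.
- exact: (cylf_integrable _ (cylf_cst d A e)).
Qed.

Lemma energy_phiF_near e : 0 < e -> exists F, [/\ fsub F (@contains0 d),
  tail_le (@contains0 d) nrm F e &
  \forall n \near \oo, forall x,
  `|energy (box n) x - \sum_(v <- box n) phiF Phi F (Defs.shift v x)| <= e * #|` box n|%:R].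
Proof.
move=> e0; have e2 : 0 < e / 2 by lra.
have [F F0 tF] := tail_exists (nrm_ge0 a0 Ploc) Psum e2.
have [r Fr] := radius F.
exists F; split=> //.
  by move=> G G0 GF; apply: le_trans (tF G G0 GF) _; lra.
have [N _ HN] := boundary_small d r (e / 2 + Pnorm Phi) e2.
exists (N + r)%N => // n /= Nn x.
have rn : (r <= n)%N by apply: leq_trans Nn; exact: leq_addl.
have nE : n = (n - r + r)%N by rewrite subnK.
have Nnr : (N <= n - r)%N by rewrite leq_subRL // addnC.
have := energy_phiF a0 Ploc Pinv Psum (n - r) x (ltW e2) F0 tF Fr.
have := HN (n - r)%N Nnr; rewrite -nE => h1 h2; apply: (le_trans h2).
have h3 : #|` box (n - r)|%:R <= #|` box n|%:R :> R.
  by rewrite ler_nat fsubset_leq_card // box_sub // leq_subr.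
have h4 : e / 2 * #|` box (n - r)|%:R <= e / 2 * #|` box n|%:R by rewrite ler_pM2l.
lra.
Qed.

Lemma energy_mean_near e : 0 < e ->
  \forall n \near \oo, forall mu : probability (X d a0) R, shift_invariant mu ->
  `|Em mu (energy (box n)) - #|` box n|%:R * phimean mu| <= e * #|` box n|%:R.
Proof.
move=> e0; have [|F [F0 tF H]] := @energy_phiF_near (e / 2); first by lra.
apply: filterS H => n H mu /invariant_Em inv; have ms := Em_state mu.
have cF := phiF_cylf Ploc F.
have := @state_dist_le _ _ (fun x => \sum_(v <- box n) phiF Phi F (Defs.shift v x))
  _ ms (energy_cylf Ploc (box n)) _ H.
rewrite (state_sum ms) => [h|v]; last exact: cylf_shift.
have {}h := h (cylf_sum _ (fun v => cylf_shift v cF)).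
rewrite (eq_bigr (fun=> Em mu (phiF Phi F))) in h; last by move=> v _; exact: inv.
rewrite big_const_seq count_predT iter_addr_0 -[_ *+ _]mulr_natl in h.
have pm := phimean_approx mu F0 tF.
have b0 := card_box_gt0 d R n.
have h2 : #|` box n|%:R * `|phimean mu - Em mu (phiF Phi F)| <= #|` box n|%:R * (e / 2).
  by rewrite ler_pM2l.
rewrite -[X in X * `|_|](ger0_norm (ltW b0)) -normrM in h2.
rewrite [X in `|X|](_ : _ = (Em mu (energy (box n)) - #|` box n|%:R * Em mu (phiF Phi F))
  - (#|` box n|%:R * (phimean mu - Em mu (phiF Phi F)))); last by lra.
by apply: le_trans (ler_normB _ _) _; lra.
Qed.

Definition Z n (b : R) : R :=
  Zpart (fun q : {ffun box n -> A} => energy (box n) (extL a0 q)) b.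
Definition gibbs_box n b : {ffun box n -> A} -> R :=
  gibbs (fun q : {ffun box n -> A} => energy (box n) (extL a0 q)) b.
Arguments gibbs_box : clear implicits.

Definition fin_state (L : {fset Zd d}) (P : {ffun L -> A} -> R) (f : config -> R) : R :=
  \sum_q P q * f (extL a0 q).

Lemma fin_stateP (L : {fset Zd d}) (P : {ffun L -> A} -> R) : (forall q, 0 <= P q) -> \sum_q P q = 1 ->
  state (fin_state P).
Proof.
move=> P0 P1; split=> [|f _ f0|c f g _ _].
- by rewrite /fin_state -[RHS]P1; apply: eq_bigr => q _; rewrite mulr1.
- by apply: sumr_ge0 => q _; exact: mulr_ge0.
by rewrite /fin_state mulr_sumr -big_split /=; apply: eq_bigr => q _; lra.
Qed.

Lemma Hs_fin_state (L : {fset Zd d}) (P : {ffun L -> A} -> R) : Hs (fin_state P) L = \sum_q eta (P q).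
Proof.
apply: eq_bigr => q _; congr eta; rewrite /prob /fin_state (bigD1 q) //=.
rewrite res_extL eqxx mulr1 big1 ?addr0 // => q' /negPf qq.
by rewrite res_extL qq mulr0.
Qed.

Let q0 n : {ffun box n -> A} := [ffun=> a0].

Definition gibbs_state n b := fin_state (gibbs_box n b).

Lemma gibbs_stateP n b : state (gibbs_state n b).
Proof.
apply: fin_stateP; last exact: (gibbs_sum _ (q0 n)).
by move=> q; exact/ltW/(gibbs_gt0 _ (q0 n)).
Qed.

Lemma ln_Z n b : Hs (gibbs_state n b) (box n) + b * gibbs_state n b (energy (box n)) =
  ln (Z n b).
Proof. by rewrite /gibbs_state Hs_fin_state; exact: (gibbs_entropy _ (q0 n)). Qed.

Lemma gibbs_variational n b (m : (config -> R) -> R) : state m ->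
  Hs m (box n) + b * m (energy (box n)) <= ln (Z n b).
Proof.
move=> ms; rewrite (state_expand a0 ms (@energy_agree _ _ _ _ Ploc (box n))) mulr_sumr.
have cr := @cylf_res d A (box n).
have := @gibbs_le R _ (prob m (res (box n)))
  (fun q => b * energy (box n) (extL a0 q)) (fun q => prob_ge0 ms q cr) (prob_sum ms cr).
by apply: le_trans; rewrite lerD2l; apply: ler_sum => q _; lra.
Qed.

(** [entropy mu] is at most the entropy per site of every box, so the finite variational inequality
    for the marginal of [mu] on [box n] is enough. *)
Lemma free_energy_le_lnZ b e : 0 < e ->
  \forall n \near \oo, forall mu : probability (X d a0) R, shift_invariant mu ->
  free_energy phi b mu * #|` box n|%:R <= ln (Z n b) + e * #|` box n|%:R.
Proof.
move=> e0; have b1 : 0 < `|b| + 1 by rewrite ltr_wpDl.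
have eb : 0 < e / (`|b| + 1) by rewrite divr_gt0.
apply: filterS (energy_mean_near eb) => n H mu inv; have {}H := H mu inv.
have bn := card_box_gt0 d R n.
have h1 := entropy_le_box n inv; rewrite ler_pdivlMr // in h1.
have h2 := gibbs_variational n b (Em_state mu).
rewrite free_energyE.
have h3 : `|b * (Em mu (energy (box n)) - #|` box n|%:R * phimean mu)| <= e * #|` box n|%:R.
  rewrite normrM; apply: le_trans (ler_wpM2l (normr_ge0 b) H) _.
  rewrite mulrA ler_pM2r // mulrCA ler_piMr ?(ltW e0) //.
  by rewrite ler_pdivrMr // mul1r lerDl.
by move: h3; rewrite ler_norml => /andP[h3 h3']; lra.
Qed.

(* [P] is an ultralimit of translation averages of finite-volume Gibbs measures. *)
Lemma equilibrium_limit b (G : set_system nat) : ProperFilter G -> \oo `<=` G ->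
  exists P : probability (X d a0) R, shift_invariant P /\
   forall c, (\forall n \near G, c * #|` box n|%:R <= ln (Z n b)) -> c <= free_energy phi b P.
Proof.
move=> PG oG; have [U [UU GU]] := ultraFilterLemma PG.
have oU : \oo `<=` U by apply: subset_trans GU.
have PU := @ultra_proper _ _ UU.
pose mm n := gibbs_state n b; have mms n : state (mm n) := gibbs_stateP n b.
have us := ulim_state a0 mms UU; have ui := ulim_invariant a0 mms UU oU.
have [P [PE PI]] := state_probability a0 us; have inv := PI ui.
exists P; split=> // c Hc.
pose hn n := Hs (mm n) (box n) / #|` box n|%:R.
have hb n : `|hn n| <= ln #|A|%:R.
  rewrite ger0_norm ?divr_ge0 ?Hs_ge0 // ler_pdivrMr ?card_box_gt0 // mulrC.
  exact: Hs_le_card.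
have hU := ultra_bounded_cvg UU hb; set h0 := lim _ in hU.
(* The entropy error is [2 * e]: [h0] against [entropy P], and [h0] against [hn n]. The energy error
   is [3 * e] times the modulus of [b]: the energy against translates of [phiF], [avg] against its
   limit, and [phiF] against the potential. *)
have key e : 0 < e -> c <= free_energy phi b P + (2 + 3 * `|b|) * e.
  move=> e0.
  have entP : h0 - e <= entropy P.
    apply: le_entropy => // k.
    have -> : Hs (Em P) (box k) = Hs (ulim mm U) (box k).
      by apply: eq_bigr => q _; rewrite /prob PE //; exact/cylf_eq/cylf_res.
    apply: (Hs_ulim_ge a0 mms UU oU).
    by apply: (cvgr_ge _ hU); lra.
  have [F [F0 tF HF]] := energy_phiF_near e0.
  have cF := phiF_cylf Ploc F.
  have pm := phimean_approx P F0 tF; rewrite PE // in pm.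
  have av := avg_cvg a0 mms UU cF.
  have [n [H1 H2 H3 H4]] : exists n, [/\ hn n <= h0 + e,
      `|ulim mm U (phiF Phi F) - avg mm n (phiF Phi F)| <= e,
      (forall x, `|energy (box n) x - \sum_(v <- box n) phiF Phi F (Defs.shift v x)|
        <= e * #|` box n|%:R) & c * #|` box n|%:R <= ln (Z n b)].
    apply: (@filter_ex _ U); near=> n; split; near: n.
    - by apply: (cvgr_le _ hU); lra.
    - by move/cvgrPdist_le : av; apply.
    - exact: oU.
    - exact: GU.
  have bn := card_box_gt0 d R n.
  have H5 := @state_dist_le _ _ (fun x => \sum_(v <- box n) phiF Phi F (Defs.shift v x))
    _ (mms n) (energy_cylf Ploc (box n)) (cylf_sum _ (fun v => cylf_shift v cF)) H3.
  rewrite (state_sum (mms n)) in H5; last by move=> v; exact: cylf_shift.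
  have H6 : \sum_(v <- box n) mm n (fun x => phiF Phi F (Defs.shift v x)) =
      avg mm n (phiF Phi F) * #|` box n|%:R by rewrite /avg divfK // gt_eqF.
  rewrite H6 in H5.
  have H7 : `|mm n (energy (box n)) - phimean P * #|` box n|%:R| <= 3 * e * #|` box n|%:R.
    have H8 : `|phimean P - avg mm n (phiF Phi F)| <= 2 * e.
      rewrite -(subrK (ulim mm U (phiF Phi F)) (phimean P)) -addrA.
      by apply: le_trans (ler_normD _ _) _; lra.
    have H9 : `|phimean P - avg mm n (phiF Phi F)| * #|` box n|%:R <= 2 * e * #|` box n|%:R.
      by rewrite ler_pM2r.
    rewrite -[X in _ * X](ger0_norm (ltW bn)) -normrM in H9.
    rewrite [X in `|X|](_ : _ = (mm n (energy (box n)) - avg mm n (phiF Phi F) * #|` box n|%:R)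
      - ((phimean P - avg mm n (phiF Phi F)) * #|` box n|%:R)); last by lra.
    by apply: le_trans (ler_normB _ _) _; lra.
  have H10 : b * mm n (energy (box n)) - b * (phimean P * #|` box n|%:R) <=
      3 * `|b| * e * #|` box n|%:R.
    rewrite -mulrBr; apply: le_trans (ler_norm _) _; rewrite normrM.
    by apply: le_trans (ler_wpM2l (normr_ge0 b) H7) _; lra.
  rewrite /hn ler_pdivrMr // in H1; rewrite -ln_Z in H4.
  rewrite -(ler_pM2r bn); apply: (le_trans H4).
  have H11 : h0 * #|` box n|%:R <= (entropy P + e) * #|` box n|%:R.
    by rewrite ler_pM2r //; lra.
  rewrite free_energyE -/(mm n); lra.
apply/ler_addgt0Pr => e e0.
have C0 : 0 < 2 + 3 * `|b| by rewrite ltr_pwDl // mulr_ge0.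
have := key (e / (2 + 3 * `|b|)); rewrite divr_gt0 // mulrCA divff ?gt_eqF // mulr1.
exact.
Unshelve. all: by end_near. Qed.

Lemma ES_nonempty b : ES phi b !=set0.
Proof.
have [P [inv HP]] := equilibrium_limit b eventually_filter (@subset_refl _ _).
exists P; split=> // nu nui; apply/ler_addgt0Pl => e e0.
rewrite -lerBlDl; apply: HP; apply: filterS (free_energy_le_lnZ b e0) => n H.
by have := H nu nui; lra.
Qed.

Lemma pressure_le b mu e : ES phi b mu -> 0 < e ->
  \forall n \near \oo, ln (Z n b) <= (free_energy phi b mu + e) * #|` box n|%:R.
Proof.
move=> [inv Hmu] e0; apply: contrapT => H.
(* If the bound failed infinitely often, a limit state taken along the bad indices [S] would have a
   free energy larger than that of the maximiser [mu]. *)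
pose S := [set n | ~ ln (Z n b) <= (free_energy phi b mu + e) * #|` box n|%:R].
have PG : ProperFilter (within S \oo).
  apply: Build_ProperFilter_ex => K [N _ KN].
  apply: contrapT => nK; apply: H; exists N => // n /= Nn; apply: contrapT => Sn.
  by apply: nK; exists n; exact: (KN n Nn Sn).
have oG : \oo `<=` within S \oo by exact: cvg_within.
have [P [Pi HP]] := equilibrium_limit b PG oG.
have : free_energy phi b mu + e <= free_energy phi b P.
  by apply: HP; exists 0%N => // n _ /negP; rewrite -ltNge => /ltW.
by have := Hmu P Pi; lra.
Qed.

Lemma pressure_ge b mu e : ES phi b mu -> 0 < e ->
  \forall n \near \oo, (free_energy phi b mu - e) * #|` box n|%:R <= ln (Z n b).
Proof.
move=> [inv _] e0; apply: filterS (free_energy_le_lnZ b e0) => n H.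
by have := H mu inv; lra.
Qed.

End Thermodynamics.

(** * Freezing *)

Section TrivialHamiltonian.
Variables (d : nat) (A : finType) (a0 : A) (R : realType).
Local Notation config := (Zd d -> A).
Local Notation box := (box d).
Variable Phi : {fset Zd d} -> config -> R.
Hypotheses (Ploc : local_interaction Phi) (Pinv : shift_invariant_interaction Phi)
  (Psum : (\esum_(L in @contains0 d) (supnorm Phi L)%:E < +oo)%E).
Local Notation energy := (energy Phi).
Local Notation phi := (fun x : X d a0 => potential Phi (x : config)).

Definition trivial_hamiltonian := forall (x y : config) k,
  (forall i, i \notin box k -> x i = y i) ->
  forall e, 0 < e -> \forall N \near \oo, `|energy (box N) y - energy (box N) x| <= e.

Definition paste (L : {fset Zd d}) (a z : config) : config :=
  fun i => if i \in L then a i else z i.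

Lemma agree_paste L a z : agree L (paste L a z) a.
Proof. by move=> i iL; rewrite /paste iL. Qed.

Lemma pasteE L a z i : i \notin L -> paste L a z i = z i.
Proof. by rewrite /paste => /negPf ->. Qed.

Lemma agree_sym L (x y : config) : agree L x y -> agree L y x.
Proof. by move=> xy i iL; rewrite xy. Qed.

Lemma agree_tr L (x y z : config) : agree L x y -> agree L y z -> agree L x z.
Proof. by move=> xy yz i iL; rewrite xy // yz. Qed.

(** Fill the outside of [box n] with the same letter for both configurations. By triviality their
    energies in some larger box [maxn M n] nearly agree; passing from there back to [box n] costs
    only [crossing], which is small compared with the volume. *)
Lemma trivial_energy_near e : trivial_hamiltonian -> 0 < e ->
  \forall n \near \oo, forall x y, `|energy (box n) y - energy (box n) x| <= e * #|` box n|%:R.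
Proof.
move=> triv e0; have e4 : 0 < e / 4 by lra.
have [r er] := nrm_tail a0 Ploc Pinv Psum e4.
have [N0 _ HN] := boundary_small d r (2 * Pnorm Phi) e4.
exists (N0 + r)%N => // n /= Nn x y.
have rn : (r <= n)%N by apply: leq_trans Nn; exact: leq_addl.
have nE : n = (n - r + r)%N by rewrite subnK.
have Nnr : (N0 <= n - r)%N by rewrite leq_subRL // addnC.
pose x' := paste (box n) x (fun=> a0); pose y' := paste (box n) y (fun=> a0).
have -> : energy (box n) x = energy (box n) x'.
  by apply: energy_agree => //; apply: agree_sym; exact: agree_paste.
have -> : energy (box n) y = energy (box n) y'.
  by apply: energy_agree => //; apply: agree_sym; exact: agree_paste.
have xy' i : i \notin box n -> x' i = y' i by move=> ni; rewrite /x' /y' !pasteE.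
have [M _ HM] := triv x' y' n xy' _ e4.
have h1 := HM (maxn M n) (leq_maxl _ _).
have h2 := energy_split a0 Ploc (box_sub d (leq_maxr M n)) xy'.
have h3 := crossing_box a0 Ploc Pinv Psum (box (maxn M n)) (n - r) (ltW e4) er.
have h4 := HN _ Nnr; rewrite -nE in h3 h4.
have h5 : #|` box (n - r)|%:R <= #|` box n|%:R :> R.
  by rewrite ler_nat fsubset_leq_card // box_sub // leq_subr.
have h6 : e / 4 * #|` box (n - r)|%:R <= e / 4 * #|` box n|%:R by rewrite ler_pM2l.
have h7 : 1 <= #|` box n|%:R :> R by rewrite ler1n box_gt0.
have h8 : e / 4 <= e / 4 * #|` box n|%:R by rewrite ler_peMr // ltW.
move: h1 h2; rewrite !ler_norml => /andP[h1 h1'] /andP[h2 h2'].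
by apply/andP; split; lra.
Qed.

Lemma trivial_phimean (mu nu : probability (X d a0) R) : trivial_hamiltonian ->
  shift_invariant mu -> shift_invariant nu -> phimean Phi mu = phimean Phi nu.
Proof.
move=> triv imu inu; apply/eqP; rewrite -subr_eq0 -normr_le0.
apply/ler_addgt0Pr => e e0; rewrite add0r; have e4 : 0 < e / 4 by lra.
have [n [H1 H2]] : exists n, (forall x y,
    `|energy (box n) y - energy (box n) x| <= e / 4 * #|` box n|%:R) /\
  (forall mu : probability (X d a0) R, shift_invariant mu ->
  `|Em mu (energy (box n)) - #|` box n|%:R * phimean Phi mu| <= e / 4 * #|` box n|%:R).
  apply: (@filter_ex _ \oo); near=> n; split; near: n.
    exact: trivial_energy_near.
  exact: energy_mean_near.
have bn := card_box_gt0 d R n.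
pose c := energy (box n) (fun=> a0).
have key (m : probability (X d a0) R) : `|Em m (energy (box n)) - c| <= e / 4 * #|` box n|%:R.
  rewrite -(state_cst (Em_state m) c).
  apply: (state_dist_le (Em_state m)) => [||z]; first exact: energy_cylf.
    exact: cylf_cst.
  exact: H1.
have h1 := H2 mu imu; have h2 := H2 nu inu; have h3 := key mu; have h4 := key nu.
rewrite -(ler_pM2r bn) -[X in `|_| * X](ger0_norm (ltW bn)) -normrM.
move: h1 h2 h3 h4; rewrite !ler_norml => /andP[? ?] /andP[? ?] /andP[? ?] /andP[? ?].
by apply/andP; split; lra.
Unshelve. all: by end_near. Qed.

Lemma trivial_ES b b' : trivial_hamiltonian -> ES phi b = ES phi b'.
Proof.
move=> triv.
have key c c' : ES phi c `<=` ES phi c'.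
  move=> mu [imu H]; split=> // nu inu; have := H nu inu; rewrite !free_energyE.
  by rewrite (trivial_phimean triv imu inu); lra.
by apply/seteqP; split; exact: key.
Qed.

End TrivialHamiltonian.

(** * Exchanging two patterns on the tiles of a box *)

Section Tiles.
Variables (d : nat) (A : finType) (a0 : A) (R : realType).
Local Notation config := (Zd d -> A).
Local Notation box := (box d).
Variable Phi : {fset Zd d} -> config -> R.
Hypotheses (Ploc : local_interaction Phi) (Pinv : shift_invariant_interaction Phi)
  (Psum : (\esum_(L in @contains0 d) (supnorm Phi L)%:E < +oo)%E).
Local Notation energy := (energy Phi).

(** The margin [r] around the differing sites [box k] keeps their whole [r]-neighbourhood in a tile.
    A tail of [h / (2 * #|box k|)] per site sums to [h / 2] over [box k], and [energy_split] doubles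
    it to [h]. *)
Variables (x y : config) (k r s : nat) (h : R).
Let m := (k + r)%N.
Let N := (m.*2.+1 * s + m)%N.
Hypotheses (xy : forall i, i \notin box k -> x i = y i)
  (hr : is_tail_radius Phi (h / (2 * #|` box k|%:R)) r).
Let D := energy (box m) y - energy (box m) x.
Hypothesis (D0 : 0 < D).

(* Since [N = (2m+1)s+m], the tiles centred at [(2m+1)j], [j] in [box s], pave
   [box N]. *)
Definition tilecenter (j : Zd d) : Zd d := \row_i (m.*2.+1%:Z * j 0%R i).
Definition tile j := trans (tilecenter j) (box m).

Lemma tile_sub j : j \in box s -> (tile j `<=` box N)%fset.
Proof.
move=> js; apply/fsubsetP => i; rewrite in_trans !in_box in js * => /forallP im.
apply/forallP => l; have := forallP js l; have := im l; rewrite !mxE.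
move: (i 0%R l) (j 0%R l) => a z ha hz; rewrite /N.
have : (`|(m.*2.+1%:Z * z)%R|%N <= m.*2.+1 * s)%N by rewrite abszM leq_mul.
by move: (m.*2.+1%:Z * z)%R ha => t ht; lia.
Qed.

Lemma tile_disj j l i : i \in tile j -> i \in tile l -> j = l.
Proof.
rewrite !in_trans !in_box => /forallP ij /forallP il; apply/rowP => t.
have := ij t; have := il t; rewrite !mxE.
by move: (i 0%R t) (j 0%R t) (l 0%R t) => a z z'; nia.
Qed.

Lemma card_boxN : #|` box N|%N = (m.*2.+1 ^ d * #|` box s|)%N.
Proof. by rewrite !card_box -expnMn; congr (_ ^ _)%N; rewrite /N; lia. Qed.

Definition pat (b : bool) (j : Zd d) : config :=
  Defs.shift (- tilecenter j) (if b then x else y).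

Definition shows b j (z : config) : bool := `[< agree (tile j) z (pat b j) >].

(** A tile showing both patterns would force [x] and [y] to agree on [box m], against [0 < D]. *)
Lemma shows_excl b j z : shows b j z -> ~~ shows (~~ b) j z.
Proof.
have nxy : ~ agree (box m) x y.
  by move=> /(energy_agree Ploc); move: D0; rewrite /D => + E; rewrite E subrr ltxx.
have key : agree (tile j) (pat true j) (pat false j) -> False.
  move=> H; apply: nxy => i im; have := H (i + tilecenter j).
  by rewrite in_trans addrK /pat /Defs.shift addrK => /(_ im).
move=> /asboolP H1; apply/negP => /asboolP H2; apply: key.
by case: b H1 H2 => H1 H2; [apply: agree_tr (agree_sym H1) H2|apply: agree_tr (agree_sym H2) H1].
Qed.

Definition swapc j (z : config) : config :=
  if shows true j z then paste (tile j) (pat false j) z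
  else if shows false j z then paste (tile j) (pat true j) z else z.

Lemma shows_agree b j z z' : agree (tile j) z z' -> shows b j z = shows b j z'.
Proof.
by move=> zz; apply/asboolP/asboolP => H; [apply: agree_tr H; exact: agree_sym|apply: agree_tr H].
Qed.

Lemma swapc_off j z i : i \notin tile j -> swapc j z i = z i.
Proof. by move=> ij; rewrite /swapc; do 2?[case: ifP => _]; rewrite ?pasteE. Qed.

Lemma shows_paste b j z : shows b j (paste (tile j) (pat b j) z).
Proof. by apply/asboolP; exact: agree_paste. Qed.

Lemma shows_swapc b j z : shows b j (swapc j z) = shows (~~ b) j z.
Proof.
rewrite /swapc; have [st|nst] := boolP (shows true j z).
  have P := shows_paste false j z; case: b => /=; last by rewrite P st.
  by rewrite (negPf (shows_excl P)) (negPf (shows_excl st)).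
have [sf|nsf] := boolP (shows false j z).
  have P := shows_paste true j z; case: b => /=; first by rewrite P sf.
  by rewrite (negPf (shows_excl P)) (negPf nst).
by case: b; rewrite /= (negPf nst) (negPf nsf).
Qed.

Lemma shows_swapc_other b j l z : j != l -> shows b l (swapc j z) = shows b l z.
Proof.
move=> jl; apply: shows_agree => i il; apply: swapc_off.
by apply: contra jl => ij; apply/eqP; exact: tile_disj ij il.
Qed.

Lemma swapcK j z : swapc j (swapc j z) = z.
Proof.
apply/funext => i; have [ij|ij] := boolP (i \in tile j); last by rewrite !swapc_off.
rewrite {1}/swapc !shows_swapc /=.
have [sf|nsf] := boolP (shows false j z).
  by move/asboolP : sf => /(_ i ij) ->; exact: agree_paste.
have [st|nst] := boolP (shows true j z).
  by move/asboolP : st => /(_ i ij) ->; exact: agree_paste.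
by rewrite /swapc (negPf nsf) (negPf nst).
Qed.

Local Notation O := {ffun box N -> A}.
Definition swp j (q : O) : O := res (box N) (swapc j (extL a0 q)).
Definition showsq j (q : O) : bool := shows true j (extL a0 q).

Lemma extL_off (L : {fset Zd d}) (q : {ffun L -> A}) i : i \notin L -> extL a0 q i = a0.
Proof. by move=> iL; rewrite /extL insubN. Qed.

Lemma extL_swp j q : j \in box s -> extL a0 (swp j q) = swapc j (extL a0 q).
Proof.
move=> js; apply/funext => i; have [iN|iN] := boolP (i \in box N).
  by rewrite /swp extL_res.
rewrite extL_off // swapc_off ?extL_off //.
by apply: contra iN; exact: (fsubsetP (tile_sub js)).
Qed.

Lemma energy_swp j q : j \in box s -> showsq j q ->
  D - h <= energy (box N) (extL a0 (swp j q)) - energy (box N) (extL a0 q) <= D + h.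
Proof.
move=> js sq; rewrite extL_swp //; set z := extL a0 q.
have st : shows true j z := sq.
have zE : swapc j z = paste (tile j) (pat false j) z by rewrite /swapc st.
have bk := card_box_gt0 d R k.
pose v := tilecenter j.
have off i : i \notin trans v (box k) -> z i = swapc j z i.
  rewrite in_trans zE => ik; have [ij|ij] := boolP (i \in tile j); last by rewrite pasteE.
  rewrite (agree_paste _ _ ij); move/asboolP : st => /(_ i ij) ->.
  by rewrite /pat /Defs.shift xy.
have := energy_split a0 Ploc (tile_sub js) off.
have -> : energy (tile j) (swapc j z) - energy (tile j) z = D.
  rewrite /tile !energy_trans // /D.
  rewrite (energy_agree Ploc (y := y)); last first.
    move=> i im; rewrite zE /Defs.shift agree_paste ?in_trans ?addrK //.
    by rewrite /pat /Defs.shift addrK.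
  rewrite (energy_agree Ploc (x := Defs.shift _ z) (y := x)) // => i im.
  have /asboolP := st; move=> /(_ (i + tilecenter j)); rewrite in_trans addrK => /(_ im).
  by rewrite /pat /Defs.shift addrK.
have : crossing Phi (box N) (tile j) (trans v (box k)) <=
    #|` trans v (box k)|%:R * (h / (2 * #|` box k|%:R)).
  apply: crossing_tail hr _ => u; rewrite in_trans => uk.
  apply/fsubsetP => i; rewrite !in_trans => ir.
  by rewrite -(subrK u i) -addrA addrC; exact: in_boxD.
rewrite card_trans => h1.
have h2 : #|` box k|%:R * (h / (2 * #|` box k|%:R)) = h / 2.
  by rewrite invfM mulrCA [X in _ * X]mulrCA divff ?gt_eqF // mulr1.
rewrite h2 in h1; rewrite ler_norml => /andP[h3 h4].
by apply/andP; split; lra.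
Qed.

Variable b : R.
Hypothesis b_gt0 : 0 < b.
Local Notation g := (@gibbs_box d A a0 R Phi N b).

(* Any pattern on a tile can be overwritten by a given one at an energy cost of
   at most [2 #|box m| Pnorm], and at most [#|A| ^ #|box m|] configurations have
   the same image. *)
Definition pmin : R :=
  (expR (b * (2 * (#|` box m|%:R * Pnorm Phi))) * #|A|%:R ^+ #|` box m|)^-1.

Lemma pmin_gt0 : 0 < pmin.
Proof.
rewrite invr_gt0 mulr_gt0 ?expR_gt0 // exprn_gt0 // ltr0n.
by apply/card_gt0P; exists a0.
Qed.

Lemma showsq_prob j : j \in box s -> pmin <= \sum_(q | showsq j q) g q.
Proof.
move=> js; set C := expR (b * (2 * (#|` box m|%:R * Pnorm Phi))).
pose T (q : O) : O := res (box N) (paste (tile j) (pat true j) (extL a0 q)).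
have ET q : extL a0 (T q) = paste (tile j) (pat true j) (extL a0 q).
  apply/funext => i; have [iN|iN] := boolP (i \in box N); first by rewrite /T extL_res.
  rewrite extL_off // pasteE ?extL_off //.
  by apply: contra iN; exact: (fsubsetP (tile_sub js)).
have TU q : showsq j (T q) by rewrite /showsq ET; exact: shows_paste.
have q0 : O := [ffun=> a0].
have gT q : g q <= C * g (T q).
  rewrite /gibbs_box /gibbs mulrA ler_pM2r ?invr_gt0 ?(Zpart_gt0 _ q0) //.
  rewrite -expRD ler_expR -mulrDr ler_pM2l // ET.
  have off i : i \notin tile j -> extL a0 q i = paste (tile j) (pat true j) (extL a0 q) i.
    by move=> ij; rewrite pasteE.
  (* With [W] empty, [crossing] sums over all sets that meet the tile and thus bounds the whole
     energy change. *)
  have := energy_split a0 Ploc (fsub0set (box N)) off.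
  have := crossing_le a0 Ploc Pinv Psum (box N) fset0 (tile j).
  have E0 z : energy fset0 z = 0.
    by rewrite /energy fpowerset0 big_mkcond big_seq_fset1 eqxx.
  rewrite !E0 card_trans ler_norml => h1 /andP[h2 h3]; lra.
(* A point of the fibre is recovered from [q'] and the letters that [T] erases on the tile. *)
have fib q' : \sum_(q | T q == q') (1 : R) <= #|A|%:R ^+ #|` box m|.
  rewrite sumr_const -natrX ler_nat.
  have -> : (#|A| ^ #|` box m|)%N = #|{: {ffun tile j -> A}}|.
    by rewrite card_ffun -cardfE card_trans.
  rewrite -(card_in_imset (f := fun q : O => res (tile j) (extL a0 q))); first exact: max_card.
  move=> q1 q2 h1 h2 /res_eqP H.
  have T1 : T q1 = q' := eqP (h1 : T q1 == q').
  have T2 : T q2 = q' := eqP (h2 : T q2 == q').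
  rewrite -(res_extL a0 q1) -(res_extL a0 q2); apply/res_eqP => i iN.
  have [ij|ij] := boolP (i \in tile j); first exact: H.
  have : extL a0 (T q1) i = extL a0 (T q2) i by rewrite T1 T2.
  by rewrite !ET !pasteE.
have C0 : 0 < C by exact: expR_gt0.
have K0 : 0 < #|A|%:R ^+ #|` box m| :> R.
  by rewrite exprn_gt0 // ltr0n; apply/card_gt0P; exists a0.
rewrite /pmin -/C -[leLHS]mul1r ler_pdivrMr ?mulr_gt0 //.
rewrite -[leLHS](gibbs_sum (fun q : O => energy (box N) (extL a0 q)) q0 b).
apply: (le_trans (ler_sum _ (fun q _ => gT q))).
rewrite -mulr_sumr mulrCA ler_pM2l //.
rewrite (partition_big T (showsq j)) //= mulr_suml; apply: ler_sum => q' _.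
rewrite (eq_bigr (fun=> g q' * 1)); last by move=> q /eqP ->; rewrite mulr1.
rewrite -mulr_sumr ler_wpM2l //.
exact: (ltW (gibbs_gt0 _ q0 b q')).
Qed.

(** At [b + 1] the perturbed Gibbs law is the trial state, at [b - 1] the unperturbed one; the mean
    energies enter with opposite signs and cancel. The volume appears because there are
    [#|box N| / (2m+1)^d] tiles, each of mass at least [pmin]. *)
Lemma lnZ_strict e : 0 < e < 1 -> 0 <= D - h -> 0 < D - (2 * b + 1) * h - 2 * e ->
  2 * ln (Z a0 Phi N b) +
   e * (D - (2 * b + 1) * h - 2 * e) * pmin / (m.*2.+1 ^ d)%:R * #|` box N|%:R <=
  ln (Z a0 Phi N (b - 1)) + ln (Z a0 Phi N (b + 1)).
Proof.
move=> e01 hD kap; have q0 : O := [ffun=> a0].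
have bb : b <= b + 1 by rewrite lerDl.
pose E (q : O) := energy (box N) (extL a0 q).
have sK j : j \in box s -> involutive (swp j).
  by move=> js q; rewrite {1}/swp extL_swp // swapcK res_extL.
have sU j : j \in box s -> forall q, showsq j q -> ~~ showsq j (swp j q).
  by move=> js q sq; rewrite /showsq extL_swp // shows_swapc; exact: (shows_excl sq).
have UU j l q : j \in box s -> l \in box s -> j != l -> showsq l (swp j q) = showsq l q.
  by move=> js ls jl; rewrite /showsq extL_swp // shows_swapc_other.
have UW j l q : j \in box s -> l \in box s -> j != l ->
    showsq l (swp l (swp j q)) = showsq l (swp l q).
  by move=> js ls jl; rewrite /showsq !extL_swp // !shows_swapc /= shows_swapc_other.
have H1 := ln_Zpart_perturb (E := E) q0 (fset_uniq (box s)) sK sU UU UW e01 b_gt0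
  bb hD energy_swp.
have H2 := @gibbs_le R O (g : O -> R) (fun q => (b - 1) * E q)
  (fun q => ltW (gibbs_gt0 E q0 b q)) (gibbs_sum E q0 b).
have H3 := gibbs_entropy E q0 b.
have H4 : #|` box s|%:R * pmin <= \sum_(j <- box s) \sum_(q | showsq j q) g q.
  rewrite mulr_natl -[X in X <= _]iter_addr_0 -(count_predT (box s)) -big_const_seq.
  rewrite big_seq [leRHS]big_seq; apply: ler_sum => j js; exact: showsq_prob.
set K := D - (2 * b + 1) * h - 2 * e in kap *.
have K1 : (b + 1) * (D - h) - b * (D + h) - 2 * e = K by rewrite /K; lra.
rewrite K1 in H1; have /andP[e0 _] := e01.
have H5 : e * K * (#|` box s|%:R * pmin) <=
    e * K * \sum_(j <- box s) \sum_(q | showsq j q) g q.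
  by rewrite ler_pM2l // mulr_gt0.
have H6 : e * K * pmin / (m.*2.+1 ^ d)%:R * #|` box N|%:R = e * K * (#|` box s|%:R * pmin).
  rewrite card_boxN natrM [X in _ * X]mulrC mulrCA -[X in _ * X]mulrA mulVf ?mulr1; last first.
    by rewrite pnatr_eq0 expn_eq0.
  by lra.
rewrite H6.
have H7 : \sum_q g q * ((b - 1) * E q) = (b - 1) * \sum_q g q * E q.
  by rewrite mulr_sumr; apply: eq_bigr => q _; rewrite mulrCA.
rewrite H7 in H2.
move: H1 H2 H3 H5; rewrite /Z /gibbs_box -/E -/(Zpart _ _); lra.
Qed.

End Tiles.

Unset Implicit Arguments.

Theorem theoremB (d : nat) (A : finType) (a0 : A) (R : realType)
  (Phi : {fset Zd d} -> (Zd d -> A) -> R) :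
  (0 < d)%N ->
  local_interaction Phi ->
  shift_invariant_interaction Phi ->
  (\esum_(L in @contains0 d) (supnorm Phi L)%:E < +oo)%E ->
  ~ freezing_phase_transition
      (fun x : X d a0 => potential Phi (x : Zd d -> A)).
Proof.
move=> _ Ploc Pinv Psum [bc [H1 H2]].
have [triv|ntriv] := pselect (trivial_hamiltonian Phi).
  by apply: (H2 (bc - 1) (bc + 1)); [lra|lra|exact: trivial_ES].
pose b : R := Num.max bc 0 + 2.
have bbc : bc <= Num.max bc 0 by rewrite le_max lexx.
have b0 : 0 <= Num.max bc 0 by rewrite le_max lexx orbT.
have bgt0 : 0 < b by rewrite /b; lra.
have [mu Emu] := ES_nonempty a0 Ploc Pinv Psum b.
have E1 : ES (fun x : X d a0 => potential Phi x) (b - 1) mu.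
  by rewrite (H1 (b - 1) b) // /b; lra.
have E3 : ES (fun x : X d a0 => potential Phi x) (b + 1) mu.
  by rewrite (H1 (b + 1) b) // /b; lra.
apply: ntriv => x y k xy delta delta0; apply: contrapT => nnear.
(* From [D >= delta - h] one gets [D - (2b + 1) h >= delta - (2b + 2) h = 3 delta / 4], which leaves
   room for [2 * e < delta / 2]. *)
pose h := delta / (4 * (2 * b + 2)).
have h0 : 0 < h by rewrite divr_gt0 //; lra.
have hdelta : (2 * b + 2) * h = delta / 4.
  by rewrite /h invfM mulrCA [X in _ * X]mulrCA divff ?mulr1 // gt_eqF //; lra.
have bh : 0 < b * h by rewrite mulr_gt0.
have bk := card_box_gt0 d R k.
have [|r hr] := @nrm_tail d A a0 R Phi Ploc Pinv Psum (h / (2 * #|` box d k|%:R)).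
  by rewrite divr_gt0 // mulr_gt0.
set m := (k + r)%N.
have key (x' y' : Zd d -> A) : (forall i, i \notin box d k -> x' i = y' i) ->
    ~ delta - h <= energy Phi (box d m) y' - energy Phi (box d m) x'.
  move=> xy' Dge; set D := energy _ _ _ - _ in Dge.
  have D0 : 0 < D by lra.
  have [e [e0 e1 e2]] : exists e : R, [/\ 0 < e, e < 1 & 2 * e < delta / 2].
    have [d1|d1] := leP (delta / 8) (1 / 2).
      by exists (delta / 8); split; lra.
    by exists (1 / 2); split; lra.
  have kap : 0 < D - (2 * b + 1) * h - 2 * e by lra.
  have hD : 0 <= D - h by lra.
  have e01 : 0 < e < 1 by rewrite e0.
  pose c := e * (D - (2 * b + 1) * h - 2 * e) * pmin Phi k r b / (m.*2.+1 ^ d)%:R.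
  have c0 : 0 < c.
    rewrite divr_gt0 ?ltr0n ?expn_gt0 // mulr_gt0 ?pmin_gt0 //.
    exact: mulr_gt0.
  (* The free energy of [mu] is affine in the parameter. The three pressure bounds, the middle one
     counted twice, lose [4 * c / 8] per site in total, less than the gain [c]. *)
  have c8 : 0 < c / 8 by lra.
  have [n1 _ P1] := pressure_le Ploc Pinv Psum E1 c8.
  have [n2 _ P2] := pressure_ge Ploc Pinv Psum Emu c8.
  have [n3 _ P3] := pressure_le Ploc Pinv Psum E3 c8.
  pose s := maxn n1 (maxn n2 n3).
  set N := (m.*2.+1 * s + m)%N.
  have sN : (s <= N)%N by rewrite (leq_trans (leq_pmull s (ltn0Sn m.*2))) ?leq_addr.
  have n1N : (n1 <= N)%N by rewrite (leq_trans _ sN) // leq_maxl.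
  have n2N : (n2 <= N)%N.
    by rewrite (leq_trans _ sN) // (leq_trans (leq_maxl n2 n3)) // leq_maxr.
  have n3N : (n3 <= N)%N.
    by rewrite (leq_trans _ sN) // (leq_trans (leq_maxr n2 n3)) // leq_maxr.
  have := lnZ_strict a0 Ploc Pinv Psum s xy' hr D0 bgt0 e01 hD kap.
  have := P1 _ n1N; have := P2 _ n2N; have := P3 _ n3N.
  rewrite -/N -/m -/c !free_energyE.
  have BN : 0 < c * #|` box d N|%:R by rewrite mulr_gt0 // card_box_gt0.
  lra.
(* For [N >= m] the energy difference in [box N] is within [h] of that in [box m]. A difference
   beyond [delta] would thus contradict [key], for [x, y] or for [y, x] according to its sign. *)
apply: nnear; exists m => // N /= mN.
rewrite leNgt; apply/negP => Ngt.
have := energy_split a0 Ploc (box_sub d mN) xy.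
have : crossing Phi (box d N) (box d m) (box d k) <=
    #|` box d k|%:R * (h / (2 * #|` box d k|%:R)).
  by apply: crossing_tail hr _ => u uk; exact: trans_box_sub.
have -> : #|` box d k|%:R * (h / (2 * #|` box d k|%:R)) = h / 2.
  by rewrite invfM mulrCA [X in _ * X]mulrCA divff ?gt_eqF // mulr1.
move=> h1; rewrite ler_norml => /andP[h2 h3].
have k1 := key x y xy; have k2 := key y x (fun i ik => esym (xy i ik)).
move: Ngt; rewrite lter_normr => /orP[h4|h4].
  by apply: k1; lra.
by apply: k2; lra.
Qed.
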